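(* Let $\mathcal{D}$ be a triangulated category and $(\mathcal{D}^{\leq 0},\mathcal{D}^{\geq 1})$ a $t$-structure on $\mathcal{D}$ with heart $\mathcal{H}$. Then there exists a bijective correspondence between (1) the set of ICE sequences in $\mathcal{H}$, and (2) the set of homology-determined preaisles in $\mathcal{D}$.
   Context: All subcategories are full, additive and closed under isomorphisms. $[1]$ is the shift of $\mathcal{D}$. $t$-structures: a pair of subcategories $(\mathcal{D}^{\leq 0},\mathcal{D}^{\geq 1})$ is a $t$-structure if $\operatorname{Hom}_{\mathcal{D}}(\mathcal{D}^{\leq 0},\mathcal{D}^{\geq 1})=0$, every $X\in\mathcal{D}$ fits in an exact triangle $U\to X\to V\to U[1]$ with $U\in\mathcal{D}^{\leq 0}$, $V\in\mathcal{D}^{\geq 1}$, and $\mathcal{D}^{\leq 0}[1]\subseteq\mathcal{D}^{\leq 0}$. Put $\mathcal{D}^{\leq n}=\mathcal{D}^{\leq 0}[-n]$, $\mathcal{D}^{\geq n+1}=\mathcal{D}^{\geq 1}[-n]$. The heart is the abelian category $\mathcal{H}=\mathcal{D}^{\leq 0}\cap\mathcal{D}^{\geq 0}$; $H^0\colon\mathcal{D}\to\mathcal{H}$ is the associated cohomological functor and $H^kX=H^0(X[k])$. Preaisles: a subcategory $\mathcal{U}$ of $\mathcal{D}$ is a preaisle if $\mathcal{U}[1]\subseteq\mathcal{U}$ and it is closed under extensions (for each exact triangle $U\to X\to V\to U[1]$ with $U,V\in\mathcal{U}$, also $X\in\mathcal{U}$). A subcategory $\mathcal{U}$ is homology-determined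 (with respect to the given $t$-structure) if for every $X\in\mathcal{D}$: $X\in\mathcal{U}$ if and only if $H^kX\in\mathcal{U}[k]$ for all $k\in\mathbb{Z}$. ICE sequences: let $\mathcal{A}$ be an abelian category. A subcategory $\mathcal{C}$ of $\mathcal{A}$ is ICE-closed if it is closed under extensions and, for every morphism $f$ between objects of $\mathcal{C}$, the image and cokernel of $f$ in $\mathcal{A}$ belong to $\mathcal{C}$. For $\mathcal{C}$ ICE-closed, put $\alpha\mathcal{C}=\{A\in\mathcal{C}\mid \ker f\in\mathcal{C}\text{ for every morphism } f\colon C\to A\text{ with }C\in\mathcal{C}\}$; this is a wide subcategory of $\mathcal{A}$ (closed under extensions, kernels and cokernels), hence itself an abelian category. A torsion class in an abelian category is a subcategory closed under extensions and quotients in that category. A sequence $\{\mathcal{C}(k)\}_{k\in\mathbb{Z}}$ of subcategories of $\mathcal{A}$ is an ICE sequence if for every $k$, $\mathcal{C}(k)$ is an ICE-closed subcategory of $\mathcal{A}$ and $\mathcal{C}(k+1)$ is a torsion class in $\alpha(\mathcal{C}(k))$. *)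

(* Defs.v *)
From mathcomp Require Import all_boot all_order all_algebra.
From mathcomp Require Import boolp classical_sets functions.
Set Implicit Arguments.
Unset Strict Implicit.
Unset Printing Implicit Defensive.
Import GRing.Theory.
Local Open Scope classical_set_scope.
Local Open Scope ring_scope.

Record preadditive := Preadditive {
  obj :> Type;
  hom : obj -> obj -> zmodType;
  idm : forall X, hom X X;
  comp : forall X Y Z, hom Y Z -> hom X Y -> hom X Z;
  comp1m : forall X Y (f : hom X Y), comp (idm Y) f = f;
  compm1 : forall X Y (f : hom X Y), comp f (idm X) = f;
  compA : forall W X Y Z (h : hom Y Z) (g : hom X Y) (f : hom W X),
    comp h (comp g f) = comp (comp h g) f;
  compDl : forall X Y Z (g1 g2 : hom Y Z) (f : hom X Y),
    comp (g1 + g2) f = comp g1 f + comp g2 f;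
  compDr : forall X Y Z (g : hom Y Z) (f1 f2 : hom X Y),
    comp g (f1 + f2) = comp g f1 + comp g f2 }.

Arguments hom {p} X Y.
Arguments idm {p} X.
Arguments comp {p X Y Z} g f.

Notation "g ∘ f" := (comp g f) (at level 40, left associativity).

Section Preadditive.
Variable A : preadditive.

Definition is_iso (X Y : A) (f : hom X Y) : Prop :=
  exists g : hom Y X, g ∘ f = idm X /\ f ∘ g = idm Y.

Definition isomorphic (X Y : A) : Prop := exists f : hom X Y, is_iso f.

Definition is_zero (O : A) : Prop :=
  forall X : A, (forall f : hom X O, f = 0) /\ (forall f : hom O X, f = 0).

Definition is_biproduct (X Y S : A) : Prop :=
  exists (i1 : hom X S) (i2 : hom Y S) (p1 : hom S X) (p2 : hom S Y),
    [/\ p1 ∘ i1 = idm X, p2 ∘ i2 = idm Y, p1 ∘ i2 = 0, p2 ∘ i1 = 0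
      & i1 ∘ p1 + i2 ∘ p2 = idm S].

Definition additive_category : Prop :=
  (exists O : A, is_zero O) /\ (forall X Y : A, exists S, is_biproduct X Y S).

Definition epi (X Y : A) (f : hom X Y) : Prop :=
  forall Z (g1 g2 : hom Y Z), g1 ∘ f = g2 ∘ f -> g1 = g2.

Definition is_kernel (X Y K : A) (f : hom X Y) (k : hom K X) : Prop :=
  f ∘ k = 0 /\
  forall W (w : hom W X), f ∘ w = 0 -> exists! u : hom W K, k ∘ u = w.

Definition is_cokernel (X Y C : A) (f : hom X Y) (c : hom Y C) : Prop :=
  c ∘ f = 0 /\
  forall W (w : hom Y W), w ∘ f = 0 -> exists! u : hom C W, u ∘ c = w.

Definition is_image (X Y I : A) (f : hom X Y) (m : hom I Y) : Prop :=
  exists (C : A) (c : hom Y C), is_cokernel f c /\ is_kernel c m.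

Definition short_exact (X Y Z : A) (f : hom X Y) (g : hom Y Z) : Prop :=
  is_kernel g f /\ is_cokernel f g.

(* Full subcategories are sets of objects; this predicate says that such a set
   is additive and closed under isomorphisms. *)
Definition subcategory (P : set A) : Prop :=
  [/\ forall O, is_zero O -> P O,
      forall X Y S, is_biproduct X Y S -> P X -> P Y -> P S
    & forall X Y, isomorphic X Y -> P X -> P Y].

Definition extension_closed (P : set A) : Prop :=
  forall (X Y Z : A) (f : hom X Y) (g : hom Y Z),
    short_exact f g -> P X -> P Z -> P Y.

Definition quotient_closed (P : set A) : Prop :=
  forall (X Y : A) (f : hom X Y), epi f -> P X -> P Y.

Definition torsion_class (T : set A) : Prop :=
  [/\ subcategory T, extension_closed T & quotient_closed T].

(* Meant for abelian A, where kernels, cokernels and images exist and are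
   unique up to isomorphism; for P closed under isomorphisms it then does not
   matter which one is used. *)
Definition kernel_in (P : set A) (X Y : A) (f : hom X Y) : Prop :=
  exists (K : A) (k : hom K X), is_kernel f k /\ P K.

Definition cokernel_in (P : set A) (X Y : A) (f : hom X Y) : Prop :=
  exists (C : A) (c : hom Y C), is_cokernel f c /\ P C.

Definition image_in (P : set A) (X Y : A) (f : hom X Y) : Prop :=
  exists (I : A) (m : hom I Y), is_image f m /\ P I.

Definition ICE_closed (P : set A) : Prop :=
  [/\ subcategory P, extension_closed P
    & forall (X Y : A) (f : hom X Y), P X -> P Y ->
        image_in P f /\ cokernel_in P f].

Definition alpha (P : set A) : set A :=
  [set Y | P Y /\ forall (X : A) (f : hom X Y), P X -> kernel_in P f].

Definition full_subcategory (P : set A) : preadditive :=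
  @Preadditive {X : A | P X} (fun X Y => hom (sval X) (sval Y))
    (fun X => idm (sval X)) (fun _ _ _ g f => g ∘ f)
    (fun _ _ => @comp1m A _ _) (fun _ _ => @compm1 A _ _)
    (fun _ _ _ _ => @compA A _ _ _ _)
    (fun _ _ _ => @compDl A _ _ _) (fun _ _ _ => @compDr A _ _ _).

End Preadditive.

(* T is a torsion class in the full subcategory W of A: epimorphisms and short
   exact sequences are those of W, not those of A. *)
Definition torsion_class_in (A : preadditive) (W T : set A) : Prop :=
  T `<=` W /\
  torsion_class (A := full_subcategory W) [set X | T (sval X)].

Definition ICE_sequence (A : preadditive) (C : int -> set A) : Prop :=
  forall k : int, ICE_closed (C k) /\ torsion_class_in (alpha (C k)) (C (k + 1)).

Record additive_functor (A B : preadditive) := AdditiveFunctor {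
  fobj :> A -> B;
  fmap : forall X Y : A, {additive hom X Y -> hom (fobj X) (fobj Y)};
  fmap_id : forall X, fmap X X (idm X) = idm (fobj X);
  fmap_comp : forall X Y Z (g : hom Y Z) (f : hom X Y),
    fmap X Z (g ∘ f) = fmap Y Z g ∘ fmap X Y f }.

Arguments fmap {A B} a {X Y}.

Definition quasi_retraction (A B : preadditive)
    (F : additive_functor A B) (G : additive_functor B A) : Prop :=
  exists eta : forall X : A, hom X (G (F X)),
    (forall X, is_iso (eta X)) /\
    (forall (X Y : A) (f : hom X Y), eta Y ∘ f = fmap G (fmap F f) ∘ eta X).

(* The shift is an autoequivalence with a chosen quasi-inverse, which covers the
   case of an automorphism. *)
Record triangulated := Triangulated {
  tri_cat :> preadditive;
  tri_additive : additive_category tri_cat;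
  shift : additive_functor tri_cat tri_cat;
  unshift : additive_functor tri_cat tri_cat;
  shiftK : quasi_retraction shift unshift;
  unshiftK : quasi_retraction unshift shift;
  (* exactness of the triangle X -> Y -> Z -> X[1] *)
  dist : forall X Y Z : tri_cat,
    hom X Y -> hom Y Z -> hom Z (shift X) -> Prop;
  dist_iso : forall (X Y Z X' Y' Z' : tri_cat)
    (f : hom X Y) (g : hom Y Z) (h : hom Z (shift X))
    (f' : hom X' Y') (g' : hom Y' Z') (h' : hom Z' (shift X'))
    (a : hom X X') (b : hom Y Y') (c : hom Z Z'),
    is_iso a -> is_iso b -> is_iso c ->
    b ∘ f = f' ∘ a -> c ∘ g = g' ∘ b -> fmap shift a ∘ h = h' ∘ c ->
    dist f g h -> dist f' g' h';
  dist_id : forall X O : tri_cat, is_zero O ->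
    dist (idm X) (0 : hom X O) (0 : hom O (shift X));
  dist_cone : forall (X Y : tri_cat) (f : hom X Y),
    exists (Z : tri_cat) (g : hom Y Z) (h : hom Z (shift X)), dist f g h;
  dist_rotate : forall (X Y Z : tri_cat)
    (f : hom X Y) (g : hom Y Z) (h : hom Z (shift X)),
    dist f g h <-> dist g h (- fmap shift f);
  dist_morphism : forall (X Y Z X' Y' Z' : tri_cat)
    (f : hom X Y) (g : hom Y Z) (h : hom Z (shift X))
    (f' : hom X' Y') (g' : hom Y' Z') (h' : hom Z' (shift X'))
    (a : hom X X') (b : hom Y Y'),
    dist f g h -> dist f' g' h' -> b ∘ f = f' ∘ a ->
    exists c : hom Z Z', c ∘ g = g' ∘ b /\ fmap shift a ∘ h = h' ∘ c;
  dist_octahedral : forall (X Y Z Z' X' Y' : tri_cat)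
    (f : hom X Y) (f1 : hom Y Z') (f2 : hom Z' (shift X))
    (g : hom Y Z) (g1 : hom Z X') (g2 : hom X' (shift Y))
    (h1 : hom Z Y') (h2 : hom Y' (shift X)),
    dist f f1 f2 -> dist g g1 g2 -> dist (g ∘ f) h1 h2 ->
    exists (u : hom Z' Y') (v : hom Y' X'),
      dist u v (fmap shift f1 ∘ g2) /\
      [/\ u ∘ f1 = h1 ∘ g, h2 ∘ u = f2, v ∘ h1 = g1
        & g2 ∘ v = fmap shift f ∘ h2] }.

Arguments shift {t}.
Arguments unshift {t}.
Arguments dist {t X Y Z} f g h.

Section Triangulated.
Variable D : triangulated.

(* X[k]; negative powers use the quasi-inverse of the shift. *)
Definition shiftz (k : int) (X : D) : D :=
  match k with
  | Posz n => iter n (fobj shift) X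
  | Negz n => iter n.+1 (fobj unshift) X
  end.

(* U[k], replete because all subcategories are closed under isomorphisms. *)
Definition shift_sub (k : int) (U : set D) : set D :=
  [set X | exists2 Y, U Y & isomorphic X (shiftz k Y)].

Definition preaisle (U : set D) : Prop :=
  [/\ subcategory U, shift_sub 1 U `<=` U
    & forall (X Y Z : D) (f : hom X Y) (g : hom Y Z) (h : hom Z (shift X)),
        dist f g h -> U X -> U Z -> U Y].

Record t_structure := TStructure {
  le0 : set D;
  ge1 : set D;
  le0_subcategory : subcategory le0;
  ge1_subcategory : subcategory ge1;
  t_orthogonal : forall (X Y : D) (f : hom X Y), le0 X -> ge1 Y -> f = 0;
  t_decomposition : forall X : D, exists UV : D * D,
    [/\ le0 UV.1, ge1 UV.2
      & exists (f : hom UV.1 X) (g : hom X UV.2) (h : hom UV.2 (shift UV.1)),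
          dist f g h];
  le0_shift : shift_sub 1 le0 `<=` le0 }.

Variable t : t_structure.

Definition D_le (n : int) : set D := shift_sub (- n) (le0 t).
Definition D_ge (n : int) : set D := shift_sub (1 - n) (ge1 t).

Definition heart : preadditive := full_subcategory (D_le 0 `&` D_ge 0).

(* The truncations, on objects; they are unique up to isomorphism. *)
Definition tau_le0 (X : D) : D := (sval (cid (t_decomposition t X))).1.
Definition tau_ge1 (X : D) : D := (sval (cid (t_decomposition t X))).2.
Definition tau_ge0 (X : D) : D := shiftz 1 (tau_ge1 (shiftz (-1) X)).

(* The objects H^0 X and H^k X, seen in D. *)
Definition H0 (X : D) : D := tau_ge0 (tau_le0 X).
Definition Hk (k : int) (X : D) : D := H0 (shiftz k X).

Definition homology_determined (U : set D) : Prop :=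
  forall X : D, U X <-> forall k : int, shift_sub k U (Hk k X).

End Triangulated.

(* Main.v *)
From Pilot Require Import Defs.
From mathcomp Require Import all_boot all_order all_algebra.
From mathcomp Require Import boolp classical_sets functions.
(* Repeated so that hom denotes morphisms of a category, not linear maps. *)
Import Pilot.Defs.
Set Implicit Arguments.
Unset Strict Implicit.
Unset Printing Implicit Defensive.
Import GRing.Theory.
Local Open Scope classical_set_scope.
Local Open Scope ring_scope.

(** The correspondence sends an ICE sequence C to the objects X with H^k X in C k
    for all k (preaisle_of), and a homology-determined preaisle U to the
    sequence of the sets of A in the heart with A[-k] in U (sequence_of).

    Once both maps are known to land in the right place, they are inverse to
    each other for simple reasons: A[-k] has A as its only cohomology, and a
    homology-determined U is recovered from the H^k X with (H^k X)[-k] in U.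

    From U to C (heart_part_ICE, heart_part_torsion): write V = U[k].  The cone Z
    of a map f of the heart has H0 Z = coker f and H-1 Z = ker f.  If f is a map
    between objects of V then Z is in V, so V contains coker f and (ker f)[1],
    and then also im f, an extension of (ker f)[1] by the source.  If the target
    of f is in V[1] then Z[-1] is in V, so V contains ker f = H0 (Z[-1]); this
    says that the heart of V[1] lies in alpha of the heart of V.  It is closed
    under the quotients of the wide subcategory alpha since a quotient B of A by
    K is an extension of K[1] by A.

    From C to U (preaisle_of_ext): for a triangle X -> Y -> Z, the object H^k Y is
    an extension of the kernel of b : H^k Z -> H^(k+1) X by the cokernel of
    a : H^(k-1) Z -> H^k X.  The kernel is in C k because C (k+1) is contained in
    alpha (C k); the cokernel is in C k because it is a quotient of H^k X within
    alpha (C (k-1)), of which C k is a torsion class.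

    Cohomology is handled as a relation is_H0 X A between objects, given by two
    truncation triangles.  The long exact sequence (long_exact_sequence) is then
    a chain of octahedra in which each step discards a vertex without cohomology
    in degree 0 (is_H0_sub, is_H0_quot), and no functor H0 has to be built on
    maps.  The abelian structure of the heart is equally read off from cones
    (heart_factorization). *)

(** * Preadditive categories *)

Section PreadditiveLemmas.
Variable A : preadditive.

Lemma comp0m (X Y Z : A) (f : hom X Y) : (0 : hom Y Z) ∘ f = 0.
Proof. by apply: (addrI ((0 : hom Y Z) ∘ f)); rewrite -compDl !addr0. Qed.

Lemma compm0 (X Y Z : A) (g : hom Y Z) : g ∘ (0 : hom X Y) = 0.
Proof. by apply: (addrI (g ∘ (0 : hom X Y))); rewrite -compDr !addr0. Qed.

Lemma compNm (X Y Z : A) (g : hom Y Z) (f : hom X Y) : (- g) ∘ f = - (g ∘ f).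
Proof. by apply: (addrI (g ∘ f)); rewrite -compDl !subrr comp0m. Qed.

Lemma compmN (X Y Z : A) (g : hom Y Z) (f : hom X Y) : g ∘ (- f) = - (g ∘ f).
Proof. by apply: (addrI (g ∘ f)); rewrite -compDr !subrr compm0. Qed.

Lemma compBl (X Y Z : A) (g1 g2 : hom Y Z) (f : hom X Y) :
  (g1 - g2) ∘ f = g1 ∘ f - g2 ∘ f.
Proof. by rewrite compDl compNm. Qed.

Lemma compBr (X Y Z : A) (g : hom Y Z) (f1 f2 : hom X Y) :
  g ∘ (f1 - f2) = g ∘ f1 - g ∘ f2.
Proof. by rewrite compDr compmN. Qed.

Lemma iso_id (X : A) : is_iso (idm X).
Proof. by exists (idm X); rewrite comp1m. Qed.

Lemma isomorphic_refl (X : A) : isomorphic X X.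
Proof. by exists (idm X); apply: iso_id. Qed.

Lemma isomorphic_sym (X Y : A) : isomorphic X Y -> isomorphic Y X.
Proof. by move=> [f [g [gf fg]]]; exists g; exists f. Qed.

Lemma isomorphic_trans (X Y Z : A) :
  isomorphic X Y -> isomorphic Y Z -> isomorphic X Z.
Proof.
move=> [f [f' [ff f'f]]] [g [g' [gg g'g]]].
exists (g ∘ f); exists (f' ∘ g'); split.
- by rewrite -compA (compA g') gg comp1m ff.
- by rewrite -compA (compA f) f'f comp1m g'g.
Qed.

Lemma is_zeroP (O : A) : is_zero O <-> idm O = 0.
Proof.
split=> [zO|e]; first by case: (zO O) => + _; apply.
move=> X; split=> f; first by rewrite -(comp1m f) e comp0m.
by rewrite -(compm1 f) e compm0.
Qed.

Lemma isomorphic_zero (O P : A) : is_zero O -> is_zero P -> isomorphic O P.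
Proof.
move=> zO zP; exists 0; exists 0; rewrite !comp0m.
by split; apply/esym; apply/is_zeroP.
Qed.

Lemma kernel_mono (X Y K : A) (f : hom X Y) (k : hom K X) :
  is_kernel f k -> forall W (w : hom W K), k ∘ w = 0 -> w = 0.
Proof.
move=> [fk kP] W w kw; have [|u [_ uP]] := kP W 0; first by rewrite compm0.
by rewrite -(uP w kw) (uP 0) ?compm0.
Qed.

Lemma cokernel_epi (X Y C : A) (f : hom X Y) (c : hom Y C) :
  is_cokernel f c -> forall W (w : hom C W), w ∘ c = 0 -> w = 0.
Proof.
move=> [cf cP] W w wc; have [|u [_ uP]] := cP W 0; first by rewrite comp0m.
by rewrite -(uP w wc) (uP 0) ?comp0m.
Qed.

Lemma kernel_unique (X Y K L : A) (f : hom X Y) (k : hom K X) (l : hom L X) :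
  is_kernel f k -> is_kernel f l -> isomorphic K L.
Proof.
move=> kK lL; have [fk kP] := kK; have [fl lP] := lL.
have [u [ku _]] := kP L l fl; have [v [lv _]] := lP K k fk.
exists v; exists u; split; apply/eqP; rewrite -subr_eq0; apply/eqP.
- by apply: (kernel_mono kK); rewrite compBr compA ku lv compm1 subrr.
- by apply: (kernel_mono lL); rewrite compBr compA lv ku compm1 subrr.
Qed.

Lemma cokernel_unique (X Y C E : A) (f : hom X Y) (c : hom Y C) (e : hom Y E) :
  is_cokernel f c -> is_cokernel f e -> isomorphic C E.
Proof.
move=> cC eE; have [cf cP] := cC; have [ef eP] := eE.
have [u [uc _]] := cP E e ef; have [v [ve _]] := eP C c cf.
exists u; exists v; split; apply/eqP; rewrite -subr_eq0; apply/eqP.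
- by apply: (cokernel_epi cC); rewrite compBl -compA uc ve comp1m subrr.
- by apply: (cokernel_epi eE); rewrite compBl -compA ve uc comp1m subrr.
Qed.

Lemma is_kernelP (X Y K : A) (f : hom X Y) (k : hom K X) :
  f ∘ k = 0 -> (forall W (w : hom W X), f ∘ w = 0 -> exists u, k ∘ u = w) ->
  (forall W (w : hom W K), k ∘ w = 0 -> w = 0) -> is_kernel f k.
Proof.
move=> fk ex mono; split=> // W w fw; have [u ku] := ex W w fw.
exists u; split=> // v kv; apply/eqP; rewrite -subr_eq0; apply/eqP.
by apply: mono; rewrite compBr ku kv subrr.
Qed.

Lemma is_cokernelP (X Y C : A) (f : hom X Y) (c : hom Y C) :
  c ∘ f = 0 -> (forall W (w : hom Y W), w ∘ f = 0 -> exists u, u ∘ c = w) ->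
  (forall W (w : hom C W), w ∘ c = 0 -> w = 0) -> is_cokernel f c.
Proof.
move=> cf ex epi; split=> // W w wf; have [u uc] := ex W w wf.
exists u; split=> // v vc; apply/eqP; rewrite -subr_eq0; apply/eqP.
by apply: epi; rewrite compBl uc vc subrr.
Qed.

End PreadditiveLemmas.

Lemma fmap_iso (A B : preadditive) (F : additive_functor A B) (X Y : A) :
  isomorphic X Y -> isomorphic (F X) (F Y).
Proof.
move=> [f [g [gf fg]]]; exists (fmap F f); exists (fmap F g).
by rewrite -!fmap_comp gf fg !fmap_id.
Qed.

Lemma fmap_zero (A B : preadditive) (F : additive_functor A B) (O : A) :
  is_zero O -> is_zero (F O).
Proof.
by move=> /is_zeroP zO; apply/is_zeroP; rewrite -fmap_id zO raddf0.
Qed.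

(** * Triangles *)

Section TriangulatedLemmas.
Variable D : triangulated.
Implicit Types X Y Z W : D.

Lemma unshift_shift X : isomorphic (unshift (shift X)) X.
Proof.
by have [e [ie _]] := shiftK D; apply: isomorphic_sym; exists (e X).
Qed.

Lemma shift_unshift X : isomorphic (shift (unshift X)) X.
Proof.
by have [e [ie _]] := unshiftK D; apply: isomorphic_sym; exists (e X).
Qed.

Lemma quasi_retraction_faithful (A B : preadditive) (F : additive_functor A B)
    (G : additive_functor B A) (X Y : A) (f : hom X Y) :
  quasi_retraction F G -> fmap F f = 0 -> f = 0.
Proof.
move=> [e [ie ne]] Ff; have [e' [e'e _]] := ie Y.
by rewrite -(comp1m f) -e'e -compA ne Ff raddf0 comp0m compm0.
Qed.

Lemma shift_faithful X Y (f : hom X Y) : fmap shift f = 0 -> f = 0.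
Proof. exact: quasi_retraction_faithful (shiftK D). Qed.

Lemma unshift_faithful X Y (f : hom X Y) : fmap unshift f = 0 -> f = 0.
Proof. exact: quasi_retraction_faithful (unshiftK D). Qed.

(** A preimage of g is the conjugate of its unshift by the unit; that it maps
    to g can be tested after one more unshift, which is faithful. *)
Lemma shift_full X Y (g : hom (shift X) (shift Y)) :
  exists f : hom X Y, fmap shift f = g.
Proof.
have [e [ie ne]] := shiftK D.
have [x' [x'e ex']] := ie X; have [y' [y'e ey']] := ie Y.
exists (y' ∘ (fmap unshift g ∘ e X)).
apply/eqP; rewrite -subr_eq0; apply/eqP.
set f := y' ∘ _.
have Tf : fmap unshift (fmap shift f) = fmap unshift g.
  rewrite -(compm1 (fmap unshift (fmap shift f))) -ex' compA -ne /f.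
  by rewrite compA ey' comp1m -compA ex' compm1.
by apply: unshift_faithful; rewrite raddfB /= Tf subrr.
Qed.

Lemma iso_opp X : is_iso (- idm X).
Proof. by exists (- idm X); rewrite compNm compmN opprK comp1m. Qed.

(** Two of the three signs of a triangle can be changed together, because - 1
    is an automorphism of the vertex that the two maps share. *)
Lemma dist_opp12 X Y Z (f : hom X Y) (g : hom Y Z) (h : hom Z (shift X)) :
  dist f g h -> dist (- f) (- g) h.
Proof.
apply: (dist_iso (iso_id X) (iso_opp Y) (iso_id Z)).
- by rewrite compNm comp1m compm1.
- by rewrite compNm compmN opprK comp1m compm1.
- by rewrite fmap_id comp1m compm1.
Qed.

Lemma dist_rot X Y Z (f : hom X Y) (g : hom Y Z) (h : hom Z (shift X)) :
  dist f g h -> dist g h (- fmap shift f).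
Proof. by move/dist_rotate. Qed.

(** The map of triangles from (X = X -> 0) given by 1 and f factors g f
    through 0. *)
Lemma dist_comp0 X Y Z (f : hom X Y) (g : hom Y Z) (h : hom Z (shift X)) :
  dist f g h -> g ∘ f = 0.
Proof.
move=> d; have [[O zO] _] := tri_additive D.
have [|c [<- _]] := dist_morphism (a := idm X) (b := f) (dist_id X zO) d.
  by [].
by rewrite compm0.
Qed.

(** Hom(W, -) is exact at the middle vertex: a map w killed by g extends to a
    map of triangles from (W = W -> 0) after one rotation. *)
Lemma dist_lift X Y Z (f : hom X Y) (g : hom Y Z) (h : hom Z (shift X)) W
    (w : hom W Y) :
  dist f g h -> g ∘ w = 0 -> exists u : hom W X, f ∘ u = w.
Proof.
move=> d gw; have [[O zO] _] := tri_additive D.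
have dW := dist_rot (dist_id W zO).
have [|c [_]] := dist_morphism (a := w) (b := 0 : hom O Z) dW (dist_rot d).
  by rewrite compm0 gw.
have [u <-] := shift_full c.
rewrite fmap_id compmN compm1 compNm -fmap_comp => /oppr_inj e.
exists u; apply/eqP; rewrite -subr_eq0; apply/eqP; apply: shift_faithful.
by rewrite raddfB /= -e subrr.
Qed.

Lemma dist_lift2 X Y Z (f : hom X Y) (g : hom Y Z) (h : hom Z (shift X)) W
    (w : hom W Z) :
  dist f g h -> h ∘ w = 0 -> exists u : hom W Y, g ∘ u = w.
Proof. by move=> /dist_rot /dist_lift; apply. Qed.

(** Dually, a map w killed by f is completed to a map of triangles to
    (0 -> W = W). *)
Lemma dist_ext X Y Z (f : hom X Y) (g : hom Y Z) (h : hom Z (shift X)) W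
    (w : hom Y W) :
  dist f g h -> w ∘ f = 0 -> exists u : hom Z W, u ∘ g = w.
Proof.
move=> d wf; have [[O zO] _] := tri_additive D.
have dW : dist (0 : hom O W) (idm W) (0 : hom W (shift O)).
  apply/dist_rotate; rewrite raddf0 oppr0; apply: dist_id.
  exact: fmap_zero.
have [|c [cg _]] := dist_morphism (a := 0 : hom X O) (b := w) d dW.
  by rewrite wf comp0m.
by exists c; rewrite cg comp1m.
Qed.

Lemma dist_ext2 X Y Z (f : hom X Y) (g : hom Y Z) (h : hom Z (shift X)) W
    (w : hom Z W) :
  dist f g h -> w ∘ g = 0 -> exists u : hom (shift X) W, u ∘ h = w.
Proof. by move=> /dist_rot /dist_ext; apply. Qed.

(** The kernel of Hom(W, X) -> Hom(W, Y) is the image of Hom(W[1], Z). *)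
Lemma dist_mono X Y Z (f : hom X Y) (g : hom Y Z) (h : hom Z (shift X)) W
    (w : hom W X) :
  dist f g h -> (forall u : hom (shift W) Z, u = 0) -> f ∘ w = 0 -> w = 0.
Proof.
move=> d Z0 fw; apply: shift_faithful.
have [|u <-] := dist_lift2 (w := fmap shift w) (dist_rot d).
  by rewrite compNm -fmap_comp fw raddf0 oppr0.
by rewrite (Z0 u) compm0.
Qed.

Lemma dist_epi X Y Z (f : hom X Y) (g : hom Y Z) (h : hom Z (shift X)) W
    (w : hom Z W) :
  dist f g h -> (forall u : hom (shift X) W, u = 0) -> w ∘ g = 0 -> w = 0.
Proof.
move=> d Z0 wg; have [u <-] := dist_ext2 d wg.
by rewrite (Z0 u) comp0m.
Qed.

Lemma dist_zero_iso X Y Z (f : hom X Y) (g : hom Y Z) (h : hom Z (shift X)) :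
  dist f g h -> is_zero Z -> isomorphic X Y.
Proof.
move=> d zZ; have [|u fu] := dist_lift (w := idm Y) d.
  by rewrite (proj1 (zZ Y) g) comp0m.
exists f; exists u; split=> //; apply/eqP; rewrite -subr_eq0; apply/eqP.
apply: (dist_mono d); first by move=> v; apply: (proj1 (zZ _)).
by rewrite compBr compA fu comp1m compm1 subrr.
Qed.

(** Backward rotation.  The desuspension Z' of Z is given with an isomorphism
    because the unshift is only a quasi-inverse; fullness of the shift produces
    the map Z' -> X. *)
Lemma dist_inv_rot X Y Z (f : hom X Y) (g : hom Y Z) (h : hom Z (shift X)) Z'
    (i : hom Z (shift Z')) :
  is_iso i -> dist f g h ->
  exists h' : hom Z' X, dist h' f (i ∘ g) /\ fmap shift h' ∘ i = - h.
Proof.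
move=> ii d; have [j [ji ij]] := ii; have [h' eh'] := shift_full (- (h ∘ j)).
exists h'; split; last by rewrite eh' compNm -compA ji compm1.
apply/dist_rotate; apply: (dist_iso (iso_id X) (iso_id Y) ii _ _ _ d).
- by rewrite comp1m compm1.
- by rewrite compm1.
- by rewrite fmap_id comp1m eh' opprK -compA ji compm1.
Qed.

(** Forgetting the maps removes the bookkeeping of signs; most arguments below
    depend on the vertices only. *)
Definition tri X Y Z : Prop :=
  exists (f : hom X Y) (g : hom Y Z) (h : hom Z (shift X)), dist f g h.

Definition has_cone X Y (f : hom X Y) (Z : D) : Prop :=
  exists (g : hom Y Z) (h : hom Z (shift X)), dist f g h.

Definition has_fibre Y Z (g : hom Y Z) (X : D) : Prop :=
  exists (f : hom X Y) (h : hom Z (shift X)), dist f g h.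

Lemma tri_rot X Y Z : tri X Y Z -> tri Y Z (shift X).
Proof. by move=> [f [g [h d]]]; do 3!eexists; apply: dist_rot d. Qed.

Lemma tri_iso X Y Z X' Y' Z' :
  isomorphic X X' -> isomorphic Y Y' -> isomorphic Z Z' -> tri X Y Z ->
  tri X' Y' Z'.
Proof.
move=> [a ia] [b ib] [c ic] [f [g [h d]]].
have [a' [a'a aa']] := ia; have [b' [b'b bb']] := ib; have [c' [c'c cc']] := ic.
exists (b ∘ f ∘ a'), (c ∘ g ∘ b'), (fmap shift a ∘ h ∘ c').
apply: (dist_iso ia ib ic _ _ _ d).
- by rewrite -!compA a'a compm1.
- by rewrite -!compA b'b compm1.
- by rewrite -!compA c'c compm1.
Qed.

Lemma has_fibre_rot Y Z (g : hom Y Z) X :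
  has_cone g (shift X) -> has_fibre g X.
Proof.
move=> [h [k d]]; have [f [d' _]] := dist_inv_rot (iso_id (shift X)) d.
by exists f, (idm (shift X) ∘ h).
Qed.

Lemma has_cone_rot Y Z (g : hom Y Z) X :
  has_fibre g X -> has_cone g (shift X).
Proof. by move=> [f [h d]]; exists h, (- fmap shift f); apply: dist_rot. Qed.

Lemma has_cone_iso X Y (f : hom X Y) Z Z' :
  isomorphic Z Z' -> has_cone f Z -> has_cone f Z'.
Proof.
move=> [c ic] [g [h d]]; have [c' [c'c cc']] := ic.
exists (c ∘ g), (h ∘ c').
apply: (dist_iso (iso_id X) (iso_id Y) ic _ _ _ d).
- by rewrite comp1m compm1.
- by rewrite compm1.
- by rewrite fmap_id comp1m -compA c'c compm1.
Qed.

Lemma fibre_exists Y Z (g : hom Y Z) : exists X, has_fibre g X.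
Proof.
have [C [h [k d]]] := dist_cone g.
exists (unshift C); apply: has_fibre_rot.
by apply: has_cone_iso (isomorphic_sym (shift_unshift C)) _; exists h, k.
Qed.

Lemma tri_inv_rot X Y Z : tri X Y Z -> tri (unshift Z) X Y.
Proof.
move=> [f [g [h d]]].
have [i ii] := isomorphic_sym (shift_unshift Z).
by have [h' [d' _]] := dist_inv_rot ii d; exists h', f, (i ∘ g).
Qed.

Lemma tri_shift X Y Z : tri X Y Z -> tri (shift X) (shift Y) (shift Z).
Proof. by move=> /tri_rot /tri_rot /tri_rot. Qed.

Lemma tri_unshift X Y Z :
  tri X Y Z -> tri (unshift X) (unshift Y) (unshift Z).
Proof. by move=> /tri_inv_rot /tri_inv_rot /tri_inv_rot. Qed.

Lemma tri_zero X O : is_zero O -> tri X X O.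
Proof. by move=> zO; exists (idm X), 0, 0; apply: dist_id. Qed.

Lemma zero_tri X O : is_zero O -> tri O X X.
Proof.
move=> zO; have := tri_inv_rot (tri_zero X zO); apply: tri_iso;
  try exact: isomorphic_refl.
by apply: isomorphic_zero => //; apply: fmap_zero.
Qed.

(** The connecting map of a cone of i1 vanishes because i1 is split monic; so
    the cone is also a cokernel of i1, as Y is. *)
Lemma tri_biproduct X Y Z : is_biproduct X Y Z -> tri X Z Y.
Proof.
move=> [i1 [i2 [p1 [p2 [e1 e2 e12 e21 e]]]]].
have [C [g [h d]]] := dist_cone i1.
have h0 : h = 0.
  have := dist_comp0 (dist_rot (dist_rot d)); rewrite compNm.
  move/eqP; rewrite oppr_eq0 => /eqP Sh.
  by rewrite -(comp1m h) -fmap_id -e1 fmap_comp -compA Sh compm0.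
have [v vg] := dist_ext d e21.
have uv : g ∘ i2 ∘ v = idm C.
  apply/eqP; rewrite -subr_eq0; apply/eqP.
  have [|w <-] := dist_ext2 (w := g ∘ i2 ∘ v - idm C) d; last first.
    by rewrite h0 compm0.
  rewrite compBl comp1m -compA vg -compA.
  have -> : i2 ∘ p2 = idm Z - i1 ∘ p1 by rewrite -e addrAC subrr add0r.
  by rewrite compBr compm1 compA (dist_comp0 d) comp0m subr0 subrr.
apply: tri_iso (isomorphic_refl X) (isomorphic_refl Z) _ _; last first.
  by exists i1, g, h.
by exists v; exists (g ∘ i2); split=> //; rewrite compA vg.
Qed.

Lemma octahedral_cone X Y Z (f : hom X Y) (g : hom Y Z) F G H :
  has_cone f F -> has_cone g G -> has_cone (g ∘ f) H -> tri F H G.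
Proof.
move=> [f1 [f2 df]] [g1 [g2 dg]] [h1 [h2 dh]].
by have [u [v [d _]]] := dist_octahedral df dg dh; do 3!eexists; apply: d.
Qed.

Lemma octahedral_fibre X Y Z (f : hom X Y) (g : hom Y Z) F G H :
  has_fibre f F -> has_fibre g G -> has_fibre (g ∘ f) H -> tri F H G.
Proof.
move=> /has_cone_rot cf /has_cone_rot cg /has_cone_rot ch.
have := tri_unshift (octahedral_cone cf cg ch).
by apply: tri_iso; apply: unshift_shift.
Qed.

End TriangulatedLemmas.

(** * Powers of the shift *)

Section ShiftPowers.
Variable D : triangulated.
Implicit Types X Y Z W : D.

Lemma shiftz_iso k X Y :
  isomorphic X Y -> isomorphic (shiftz k X) (shiftz k Y).
Proof.
move=> XY; case: k => n; rewrite /shiftz.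
- by elim: n => // n; apply: fmap_iso.
- by elim: n => [|n]; apply: fmap_iso.
Qed.

Lemma shiftz_tri k X Y Z :
  tri X Y Z -> tri (shiftz k X) (shiftz k Y) (shiftz k Z).
Proof.
move=> XYZ; case: k => n; rewrite /shiftz.
- by elim: n => // n; apply: tri_shift.
- by elim: n => [|n]; apply: tri_unshift.
Qed.

Lemma shiftz_zero k X : is_zero X -> is_zero (shiftz k X).
Proof.
move=> zX; case: k => n; rewrite /shiftz.
- by elim: n => // n; apply: fmap_zero.
- by elim: n => [|n]; apply: fmap_zero.
Qed.

Lemma shiftzS k X : isomorphic (shiftz (k + 1) X) (shift (shiftz k X)).
Proof.
case: k => n.
- have -> : Posz n + 1 = Posz n.+1 by rewrite -addn1.
  exact: isomorphic_refl.
- have -> : Negz n + 1 = - n%:Z by rewrite NegzE -addn1 PoszD opprD subrK.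
  case: n => [|n]; first by apply/isomorphic_sym/shift_unshift.
  rewrite -NegzE; apply/isomorphic_sym; exact: shift_unshift.
Qed.

Lemma shiftzP k X : isomorphic (shiftz (k - 1) X) (unshift (shiftz k X)).
Proof.
apply: isomorphic_trans (isomorphic_sym (unshift_shift _)) _.
apply/fmap_iso/isomorphic_sym.
by have := shiftzS (k - 1) X; rewrite subrK.
Qed.

(** Holds for all integers although the negative powers use the quasi-inverse:
    the two inductive steps are the comparison of shiftz at k with its
    neighbours. *)
Lemma shiftzD k l X : isomorphic (shiftz (k + l) X) (shiftz k (shiftz l X)).
Proof.
elim/int_ind: k => [|n IH|n IH].
- by rewrite add0r; apply: isomorphic_refl.
- have -> : n.+1%:Z + l = n%:Z + l + 1 by rewrite -addn1 PoszD addrAC.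
  apply: isomorphic_trans (shiftzS _ _) _; apply: fmap_iso; exact: IH.
- have -> : - n.+1%:Z + l = - n%:Z + l - 1 by rewrite -addn1 PoszD opprD addrAC.
  apply: isomorphic_trans (shiftzP _ _) _.
  have -> : - n.+1%:Z = - n%:Z - 1 by rewrite -addn1 PoszD opprD.
  apply/isomorphic_sym; apply: isomorphic_trans (shiftzP _ _) _.
  by apply/fmap_iso/isomorphic_sym.
Qed.

Lemma shiftzK k X : isomorphic (shiftz k (shiftz (- k) X)) X.
Proof.
apply: isomorphic_trans (isomorphic_sym (shiftzD _ _ _)) _.
by rewrite subrr; apply: isomorphic_refl.
Qed.

Lemma shiftzNK k X : isomorphic (shiftz (- k) (shiftz k X)) X.
Proof. by have := shiftzK (- k) X; rewrite opprK. Qed.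

Lemma shiftz_shift k X :
  isomorphic (shiftz k (shift X)) (shift (shiftz k X)).
Proof.
apply: isomorphic_trans (shiftzS k X); apply: isomorphic_sym.
exact: shiftzD k 1 X.
Qed.

End ShiftPowers.

(** * Truncation and cohomology in degree 0 *)

Section TStructureLemmas.
Variables (D : triangulated) (t : t_structure D).
Implicit Types X Y Z W : D.

Definition hom0 X Y : Prop := forall f : hom X Y, f = 0.

Lemma hom0_iso X Y X' Y' :
  isomorphic X X' -> isomorphic Y Y' -> hom0 X Y -> hom0 X' Y'.
Proof.
move=> [a [a' [_ aa']]] [b [b' [_ bb']]] XY f.
rewrite -(comp1m f) -bb' -(compm1 f) -aa' -!compA (compA f) (compA b').
by rewrite (XY (b' ∘ (f ∘ a))) comp0m compm0.
Qed.

Lemma hom0_shift X Y : hom0 (shift X) (shift Y) -> hom0 X Y.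
Proof. by move=> XY f; apply: shift_faithful; apply: XY. Qed.

Lemma hom0_unshift X Y : hom0 (unshift X) (unshift Y) -> hom0 X Y.
Proof. by move=> XY f; apply: unshift_faithful; apply: XY. Qed.

(** A triangle with the given orthogonality on its ends is determined by its
    middle vertex: the identity of X lifts to both ends, and the lifts are
    unique. *)
Lemma tri_unique X U V U' V' :
  hom0 U V' -> hom0 U' V -> hom0 (shift U) V -> hom0 (shift U') V' ->
  tri U X V -> tri U' X V' -> isomorphic U U' /\ isomorphic V V'.
Proof.
move=> UV' U'V SUV SU'V' [f [g [h d]]] [f' [g' [h' d']]].
have [a fa] := dist_lift d' (UV' (g' ∘ f)).
have [b fb] := dist_lift d (U'V (g ∘ f')).
have [c gc] := dist_ext d (UV' (g' ∘ f)).
have [e ge] := dist_ext d' (U'V (g ∘ f')).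
have back (P Q M N : D) (i : hom P X) (j : hom X M) (k : hom M (shift P))
    (u : hom P Q) (v : hom Q P) (w : hom M N) (z : hom N M) :
    dist i j k -> hom0 (shift P) M -> i ∘ (v ∘ u) = i -> (z ∘ w) ∘ j = j ->
    v ∘ u = idm P /\ z ∘ w = idm M.
  move=> dd PM ivu zwj; split; apply/eqP; rewrite -subr_eq0; apply/eqP.
  - by apply: (dist_mono dd); rewrite ?compBr ?ivu ?compm1 ?subrr.
  - by apply: (dist_epi dd); rewrite ?compBl ?zwj ?comp1m ?subrr.
have [|||ba ec] := back U U' V V' f g h a b c e d => //.
- by rewrite compA fb fa.
- by rewrite -compA gc ge.
have [|||ab ce] := back U' U V' V f' g' h' b a e c d' => //.
- by rewrite compA fa fb.
- by rewrite -compA ge gc.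
by split; [exists a; exists b|exists c; exists e].
Qed.

Lemma le0_iso X Y : isomorphic X Y -> le0 t X -> le0 t Y.
Proof. by have [_ _] := le0_subcategory t; apply. Qed.

Lemma ge1_iso X Y : isomorphic X Y -> ge1 t X -> ge1 t Y.
Proof. by have [_ _] := ge1_subcategory t; apply. Qed.

Lemma le0_shifted X : le0 t X -> le0 t (shift X).
Proof.
by move=> X0; apply: (@le0_shift D t); exists X => //; apply: isomorphic_refl.
Qed.

Lemma le0_ge1 X Y : le0 t X -> ge1 t Y -> hom0 X Y.
Proof. by move=> X0 Y1 f; apply: t_orthogonal X0 Y1. Qed.

Lemma truncation X : exists U V : D, [/\ le0 t U, ge1 t V & tri U X V].
Proof.
have [[U V] [/= U0 V1 d]] := t_decomposition t X.
by exists U; exists V.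
Qed.

(** Each half of the t-structure is the orthogonal of the other, since the other
    end of the truncation triangle then has a vanishing identity.  Closure under
    extensions follows. *)
Lemma le0P X : le0 t X <-> forall V, ge1 t V -> hom0 X V.
Proof.
split=> [X0 V|XV]; first exact: le0_ge1.
have [U [V [U0 V1 [f [g [h d]]]]]] := truncation X.
apply: le0_iso (U0); apply: (dist_zero_iso d); apply/is_zeroP.
apply: (dist_epi d); last exact: XV.
exact: le0_ge1 (le0_shifted U0) V1.
Qed.

Lemma ge1P X : ge1 t X <-> forall U, le0 t U -> hom0 U X.
Proof.
split=> [X1 U U0|UX]; first exact: le0_ge1.
have [U [V [U0 V1 [f [g [h d]]]]]] := truncation X.
have zU : is_zero U.
  apply/is_zeroP; apply: (dist_mono d); last exact: UX.
  exact: le0_ge1 (le0_shifted U0) V1.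
apply: ge1_iso (V1); apply: isomorphic_sym.
by apply: (dist_zero_iso (dist_rot d)); apply: fmap_zero.
Qed.

Lemma le0_ext X Y Z : tri X Y Z -> le0 t X -> le0 t Z -> le0 t Y.
Proof.
move=> [f [g [h d]]] /le0P X0 /le0P Z0; apply/le0P => V V1 w.
have [u <-] := dist_ext d (X0 V V1 (w ∘ f)).
by rewrite (Z0 V V1 u) comp0m.
Qed.

Lemma ge1_ext X Y Z : tri X Y Z -> ge1 t X -> ge1 t Z -> ge1 t Y.
Proof.
move=> [f [g [h d]]] /ge1P X1 /ge1P Z1; apply/ge1P => U U0 w.
have [u <-] := dist_lift d (Z1 U U0 (g ∘ w)).
by rewrite (X1 U U0 u) compm0.
Qed.

Lemma ge1_unshift X : ge1 t X -> ge1 t (unshift X).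
Proof.
move=> X1; apply/ge1P => U U0; apply: hom0_shift.
apply: (hom0_iso (isomorphic_refl _) (isomorphic_sym (shift_unshift X))).
exact: le0_ge1 (le0_shifted U0) X1.
Qed.

Definition leN1 X : Prop := le0 t (unshift X).
Definition ge0 X : Prop := ge1 t (unshift X).

Lemma leN1_le0 X : leN1 X -> le0 t X.
Proof. by move=> /le0_shifted; apply: le0_iso; apply: shift_unshift. Qed.

Lemma leN1_shift X : le0 t X -> leN1 (shift X).
Proof. by apply: le0_iso; apply/isomorphic_sym/unshift_shift. Qed.

Lemma ge0_shift X : ge1 t X -> ge0 (shift X).
Proof. by apply: ge1_iso; apply/isomorphic_sym/unshift_shift. Qed.

Lemma leN1_ge0 X Y : leN1 X -> ge0 Y -> hom0 X Y.
Proof. by move=> X0 Y1; apply: hom0_unshift; apply: le0_ge1. Qed.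

Lemma leN1_shifted X : leN1 X -> leN1 (shift X).
Proof. by move=> /leN1_le0; apply: leN1_shift. Qed.

Lemma ge0_iso X Y : isomorphic X Y -> ge0 X -> ge0 Y.
Proof. by move=> XY; apply: ge1_iso; apply: fmap_iso. Qed.

Lemma leN1_ext X Y Z : tri X Y Z -> leN1 X -> leN1 Z -> leN1 Y.
Proof. by move=> /tri_unshift; apply: le0_ext. Qed.

Lemma ge0_ext X Y Z : tri X Y Z -> ge0 X -> ge0 Z -> ge0 Y.
Proof. by move=> /tri_unshift; apply: ge1_ext. Qed.

Lemma truncationN1 X : exists N V : D, [/\ leN1 N, ge0 V & tri N X V].
Proof.
have [U [V [U0 V1 d]]] := truncation (unshift X).
exists (shift U); exists (shift V).
split; [exact: leN1_shift|exact: ge0_shift|].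
by apply: tri_iso (tri_shift d); try exact: isomorphic_refl;
  apply: shift_unshift.
Qed.

Definition in_heart X : Prop := le0 t X /\ ge0 X.

Lemma in_heart_iso X Y : isomorphic X Y -> in_heart X -> in_heart Y.
Proof.
by move=> XY [X0 X0']; split; [apply: le0_iso X0|apply: ge0_iso X0'].
Qed.

Lemma in_heart_ext X Y Z : tri X Y Z -> in_heart X -> in_heart Z -> in_heart Y.
Proof.
move=> d [X0 X0'] [Z0 Z0'].
by split; [apply: le0_ext d _ _|apply: ge0_ext d _ _].
Qed.

Lemma in_heart_zero O : is_zero O -> in_heart O.
Proof.
move=> zO; split.
- by apply/le0P => V _ f; apply: (proj2 (zO V)).
- by apply/ge1P => U _ f; apply: (proj1 (fmap_zero unshift zO U)).
Qed.

Lemma heartP X : (D_le t 0 `&` D_ge t 0) X <-> in_heart X.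
Proof.
rewrite /D_le /D_ge /shift_sub oppr0 subr0; split.
- move=> [[U U0 XU] [V V1 XV]]; split.
    by apply: le0_iso U0; apply: isomorphic_sym.
  by apply: ge0_iso (ge0_shift V1); apply: isomorphic_sym.
- move=> [X0 X1]; split; first by exists X => //; apply: isomorphic_refl.
  by exists (unshift X) => //; apply/isomorphic_sym/shift_unshift.
Qed.

(** A is the zeroth cohomology of X, up to isomorphism: the two truncation
    triangles, without a choice of truncations.  Every argument about cohomology
    below manipulates this relation, and never the maps induced by a cohomology
    functor. *)
Definition is_H0 X A : Prop :=
  in_heart A /\ exists U V N : D,
    [/\ le0 t U, ge1 t V & leN1 N] /\ (tri U X V /\ tri N U A).

Lemma is_H0_exists X : exists A, is_H0 X A.
Proof.
have [U [V [U0 V1 d]]] := truncation X.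
have [N [A [N0 A0 d']]] := truncationN1 U.
exists A; split; last by exists U, V, N.
split=> //; apply: le0_ext (tri_rot d') (U0) _.
exact/le0_shifted/leN1_le0.
Qed.

Lemma truncation_unique X U V U' V' :
  le0 t U -> ge1 t V -> le0 t U' -> ge1 t V' ->
  tri U X V -> tri U' X V' -> isomorphic U U' /\ isomorphic V V'.
Proof.
move=> U0 V1 U0' V1'.
by apply: tri_unique; apply: le0_ge1 => //; apply: le0_shifted.
Qed.

Lemma truncationN1_unique X U V U' V' :
  leN1 U -> ge0 V -> leN1 U' -> ge0 V' ->
  tri U X V -> tri U' X V' -> isomorphic U U' /\ isomorphic V V'.
Proof.
move=> U0 V1 U0' V1'.
by apply: tri_unique; apply: leN1_ge0 => //; apply: leN1_shifted.
Qed.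

Lemma is_H0_unique X A A' : is_H0 X A -> is_H0 X A' -> isomorphic A A'.
Proof.
move=> [[_ A0] [U [V [N [[U0 V1 N0] [d e]]]]]].
move=> [[_ A0'] [U' [V' [N' [[U0' V1' N0'] [d' e']]]]]].
have [UU' _] := truncation_unique U0 V1 U0' V1' d d'.
have e2 := tri_iso (isomorphic_refl N) UU' (isomorphic_refl A) e.
by have [] := truncationN1_unique N0 A0 N0' A0' e2 e'.
Qed.

Lemma is_H0_iso X A X' A' :
  isomorphic X X' -> isomorphic A A' -> is_H0 X A -> is_H0 X' A'.
Proof.
move=> XX' AA' [hA [U [V [N [[U0 V1 N0] [d e]]]]]].
split; first exact: in_heart_iso hA.
exists U, V, N; split=> //; split.
- by apply: tri_iso d => //; exact: isomorphic_refl.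
- by apply: tri_iso e => //; exact: isomorphic_refl.
Qed.

Lemma is_H0_intro X A N : leN1 N -> in_heart A -> tri N X A -> is_H0 X A.
Proof.
move=> N0 hA d; have [[O zO] _] := tri_additive D.
split=> //; exists X, O, N; split; last by split=> //; apply: tri_zero.
split=> //; first by apply: le0_ext d _ (proj1 hA); exact: leN1_le0.
by apply/ge1P => U _ f; apply: (proj1 (zO U)).
Qed.

Lemma is_H0_heart A : in_heart A -> is_H0 A A.
Proof.
move=> hA; have [[O zO] _] := tri_additive D.
apply: (is_H0_intro (N := O)) => //; last exact: zero_tri.
by have [] := in_heart_zero (fmap_zero unshift zO).
Qed.

Lemma is_H0_sub1 U Y V A : tri U Y V -> ge1 t V -> is_H0 U A -> is_H0 Y A.
Proof.
move=> [f [g [h d]]] V1 [hA [U' [W [N [[U0 W1 N0] [[f' [g' [h' d']]] e]]]]]].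
split=> //; exists U'; have [C [a [b c]]] := dist_cone (f ∘ f').
exists C, N; split; last by split=> //; exists (f ∘ f'), a, b.
split=> //; apply: ge1_ext _ W1 V1.
by apply: (octahedral_cone (f := f') (g := f)); do 2!eexists; eassumption.
Qed.

(** The left-to-right direction is the octahedral axiom, which turns the
    truncation of U into one of Y; uniqueness of cohomology then gives the
    converse. *)
Lemma is_H0_sub U Y V A : tri U Y V -> ge1 t V -> is_H0 U A <-> is_H0 Y A.
Proof.
move=> d V1; split; first exact: is_H0_sub1 d V1.
have [B hB] := is_H0_exists U; move/is_H0_unique/(_ (is_H0_sub1 d V1 hB)).
move=> AB; apply: is_H0_iso hB; first exact: isomorphic_refl.
exact: isomorphic_sym.
Qed.

(** The truncation of Y at 0 is the fibre F of the map from Y to the part of P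
    of degrees at least 1, and F is an extension of the truncation of P by M. *)
Lemma is_H0_quot1 M Y P A : tri M Y P -> leN1 M -> is_H0 P A -> is_H0 Y A.
Proof.
move=> [f [g [h d]]] M0.
move=> [hA [U [V [N [[U0 V1 N0] [[i [p [r d']]] [n [q [s e]]]]]]]]].
have [F fF] := fibre_exists (p ∘ g).
have MFU : tri M F U.
  by apply: (octahedral_fibre (f := g) (g := p)) fF; do 2!eexists; eassumption.
have [j [k [l dj]]] := MFU.
have [G fG] := fibre_exists (q ∘ k).
have MGN : tri M G N.
  by apply: (octahedral_fibre (f := k) (g := q)) fG; do 2!eexists; eassumption.
split=> //; exists F, V, G; split.
- split=> //; last exact: leN1_ext MGN M0 N0.
  by apply: le0_ext MFU _ U0; exact: leN1_le0.
- have [f1 [h1 d1]] := fF; have [f2 [h2 d2]] := fG.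
  by split; do 3!eexists; eassumption.
Qed.

Lemma is_H0_quot M Y P A : tri M Y P -> leN1 M -> is_H0 P A <-> is_H0 Y A.
Proof.
move=> d M0; split; first exact: is_H0_quot1 d M0.
have [B hB] := is_H0_exists P; move/is_H0_unique/(_ (is_H0_quot1 d M0 hB)).
move=> AB; apply: is_H0_iso hB; first exact: isomorphic_refl.
exact: isomorphic_sym.
Qed.

Lemma is_H0_leN1 X O : leN1 X -> is_zero O -> is_H0 X O.
Proof.
by move=> X0 zO; apply: is_H0_intro X0 (in_heart_zero zO) (tri_zero X zO).
Qed.

Lemma is_H0_ge1 X O : ge1 t X -> is_zero O -> is_H0 X O.
Proof.
move=> X1 zO; apply/(is_H0_sub _ (zero_tri X zO) X1).
exact/is_H0_heart/in_heart_zero.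
Qed.

Lemma is_H0_le0E X A : le0 t X -> is_H0 X A -> exists2 N, leN1 N & tri N X A.
Proof.
move=> X0 hX; have [N [B [N0 B0 d]]] := truncationN1 X.
have hB : in_heart B.
  split=> //; apply: le0_ext (tri_rot d) (X0) _.
  exact/le0_shifted/leN1_le0.
exists N => //; apply: tri_iso (d); try exact: isomorphic_refl.
exact: is_H0_unique (is_H0_intro N0 hB d) hX.
Qed.

Lemma is_H0_ge0E X A : ge0 X -> is_H0 X A -> exists2 V, ge1 t V & tri A X V.
Proof.
move=> X0 hX; have [B [V [B0 V1 d]]] := truncation X.
have hB : in_heart B.
  split=> //; apply: ge1_ext (tri_unshift (tri_inv_rot d)) _ X0.
  by do 2!apply: ge1_unshift.
exists V => //; apply: tri_iso (d); try exact: isomorphic_refl.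
apply: is_H0_unique _ (hX); apply/(is_H0_sub _ d V1); exact: is_H0_heart.
Qed.

(** Three backward rotations desuspend a triangle. *)
Lemma has_cone_unshift X Y (e : hom X Y) N :
  has_cone (fmap shift e) (shift N) -> has_cone e N.
Proof.
move=> [v [w d0]].
have [a [d1 _]] := dist_inv_rot (iso_id _) d0.
have [b [d2 _]] := dist_inv_rot (iso_id _) d1.
have [c [d3]] := dist_inv_rot (iso_id _) d2.
rewrite compm1 comp1m => /eqP; rewrite -subr_eq0 opprK -raddfD => /eqP.
move=> /shift_faithful/eqP; rewrite addr_eq0 => /eqP ce.
exists (- b); eexists.
by move: (dist_opp12 d3); rewrite ce opprK; apply.
Qed.

(** The abelian structure of the heart comes from the cone Z of a map f of the
    heart, which has cohomology in degrees - 1 and 0 only: these are ker f and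
    coker f, and the octahedral axiom applied to Y -> Z -> coker f produces the
    image of f. *)
Lemma heart_factorization X Y Z (f : hom X Y) :
  in_heart X -> in_heart Y -> has_cone f Z ->
  exists (K I Q : D) (k : hom K X) (e : hom X I) (m : hom I Y) (c : hom Y Q),
    [/\ in_heart K, in_heart I & in_heart Q] /\
    [/\ f = m ∘ e, exists h, dist k e h, exists h, dist m c h
      & tri (shift K) Z Q].
Proof.
move=> hX hY [g [h d]].
have [N [Q [N0 Q0 [n [q [r d']]]]]] := truncationN1 Z.
have Z0 : le0 t Z.
  apply: le0_ext (_ : tri Y Z (shift X)) (proj1 hY) (le0_shifted (proj1 hX)).
  by apply: tri_rot; exists f, g, h.
have NZQ : tri N Z Q by exists n, q, r.
have hQ : in_heart Q.
  split=> //; apply: le0_ext (tri_rot NZQ) Z0 _.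
  exact/le0_shifted/leN1_le0.
have NK := shift_unshift N.
have hK : in_heart (unshift N).
  split=> //; apply: ge1_ext (tri_unshift (tri_unshift (tri_inv_rot NZQ))) _ _.
    by do 2!apply: ge1_unshift.
  have YZX : tri Y Z (shift X) by apply: tri_rot; exists f, g, h.
  apply: ge1_ext (tri_unshift (tri_unshift YZX)) _ _.
    by apply: ge1_unshift; case: hY.
  apply: ge1_iso (proj2 hX); apply/isomorphic_sym/fmap_iso/unshift_shift.
have [I [m [s dI]]] := fibre_exists (q ∘ g).
have [u [v [duv [_ mu _ _]]]] :=
  dist_octahedral (dist_rot d) (dist_rot d') (dist_rot dI).
have [e ue] := shift_full u.
have fe : f = m ∘ e.
  apply/eqP; rewrite -subr_eq0; apply/eqP; apply: shift_faithful.
  move/eqP: mu; rewrite raddfB /= fmap_comp ue compNm eqr_opp => /eqP ->.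
  by rewrite subrr.
have [k [w dk]] : has_fibre e (unshift N).
  apply: has_fibre_rot; apply: has_cone_iso (isomorphic_sym NK) _.
  by apply: has_cone_unshift; rewrite ue; exists v; eexists; apply: duv.
exists (unshift N), I, Q, k, e, m, (q ∘ g); split.
- split=> //; split.
  + apply: le0_ext (_ : tri X I (shift (unshift N))) (proj1 hX) _.
      by apply: tri_rot; do 3!eexists; apply: dk.
    by apply: le0_iso (leN1_le0 N0); apply: isomorphic_sym.
  + apply: ge0_ext (_ : tri (unshift Q) I Y) _ (proj2 hY).
      by apply: tri_inv_rot; do 3!eexists; apply: dI.
    exact: ge1_unshift Q0.
- split=> //; [by exists w|by exists s|].
  apply: tri_iso NZQ; try exact: isomorphic_refl.
  exact: isomorphic_sym.
Qed.

End TStructureLemmas.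

(** * Kernels and cokernels in the heart *)

Section HeartLemmas.
Variables (D : triangulated) (t : t_structure D).
Implicit Types (X Y Z W : D) (A B C : heart t).

Definition hval A : D := sval A.

Definition to_heart X (hX : in_heart t X) : heart t :=
  exist _ X (proj2 (heartP t X) hX).

Lemma hvalP A : in_heart t (hval A).
Proof. exact: (proj1 (heartP t _) (svalP A)). Qed.

Lemma hval_zero A : is_zero (hval A) <-> is_zero A.
Proof. by split=> /is_zeroP zA; apply/is_zeroP. Qed.

Lemma heart_hom0_shift X Y : in_heart t X -> in_heart t Y -> hom0 (shift X) Y.
Proof. by move=> [X0 _] [_ Y0]; apply: leN1_ge0 Y0; apply: leN1_shift. Qed.

Lemma heart_kernelP A B C (f : @hom D (hval A) (hval B))
    (k : @hom D (hval C) (hval A)) :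
  f ∘ k = 0 ->
  (forall W (w : hom W (hval A)), in_heart t W -> f ∘ w = 0 ->
     exists u, k ∘ u = w) ->
  (forall W (w : hom W (hval C)), in_heart t W -> k ∘ w = 0 -> w = 0) ->
  @is_kernel (heart t) A B C f k.
Proof.
move=> fk ex mono; apply: is_kernelP => //.
- by move=> W w; apply: (ex (hval W)); apply: hvalP.
- by move=> W w; apply: (mono (hval W)); apply: hvalP.
Qed.

Lemma heart_kernelE A B C (f : @hom D (hval A) (hval B))
    (k : @hom D (hval C) (hval A)) :
  @is_kernel (heart t) A B C f k ->
  [/\ f ∘ k = 0,
      forall W (w : hom W (hval A)), in_heart t W -> f ∘ w = 0 ->
        exists u, k ∘ u = w
    & forall W (w : hom W (hval C)), in_heart t W -> k ∘ w = 0 -> w = 0].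
Proof.
move=> kK; have [fk kP] := kK; split=> //.
- move=> W w hW fw; have [u [ku _]] := kP (to_heart hW) w fw.
  by exists u.
- by move=> W w hW; apply: (kernel_mono kK (W := to_heart hW)).
Qed.

Lemma heart_cokernelP A B C (f : @hom D (hval A) (hval B))
    (c : @hom D (hval B) (hval C)) :
  c ∘ f = 0 ->
  (forall W (w : hom (hval B) W), in_heart t W -> w ∘ f = 0 ->
     exists u, u ∘ c = w) ->
  (forall W (w : hom (hval C) W), in_heart t W -> w ∘ c = 0 -> w = 0) ->
  @is_cokernel (heart t) A B C f c.
Proof.
move=> cf ex epi; apply: is_cokernelP => //.
- by move=> W w; apply: (ex (hval W)); apply: hvalP.
- by move=> W w; apply: (epi (hval W)); apply: hvalP.
Qed.

Lemma dist_heart_kernel A B C (f : @hom D (hval A) (hval B))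
    (g : @hom D (hval B) (hval C)) h :
  dist f g h -> @is_kernel (heart t) B C A g f.
Proof.
move=> d; apply: heart_kernelP; first exact: dist_comp0 d.
- by move=> W w _; apply: dist_lift d.
- by move=> W w hW; apply: (dist_mono d); exact: heart_hom0_shift hW (hvalP C).
Qed.

Lemma dist_heart_cokernel A B C (f : @hom D (hval A) (hval B))
    (g : @hom D (hval B) (hval C)) h :
  dist f g h -> @is_cokernel (heart t) A B C f g.
Proof.
move=> d; apply: heart_cokernelP; first exact: dist_comp0 d.
- by move=> W w _; apply: dist_ext d.
- by move=> W w hW; apply: (dist_epi d); exact: heart_hom0_shift (hvalP A) hW.
Qed.

(** Kernel, image and cokernel of a map of the heart, together with their
    relation to the given cone, whose H-1 and H0 are K and Q. *)
Lemma heart_factor A B (f : @hom D (hval A) (hval B)) (Z : D) :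
  has_cone f Z ->
  exists (K I Q : heart t) (k : @hom (heart t) K A)
    (m : @hom D (hval I) (hval B)) (c : @hom D (hval B) (hval Q)),
    [/\ @is_kernel (heart t) A B K f k, @is_cokernel (heart t) A B Q f c
      & exists h, dist m c h] /\
    [/\ tri (hval K) (hval A) (hval I), tri (hval I) (hval B) (hval Q)
      & tri (shift (hval K)) Z (hval Q)].
Proof.
move=> fZ.
have [K [I [Q [k [e [m [c [[hK hI hQ] [fE [h d] [h' d'] kZQ]]]]]]]]] :=
  heart_factorization (hvalP A) (hvalP B) fZ.
exists (to_heart hK), (to_heart hI), (to_heart hQ), k, m, c.
split; last by split=> //; do 3!eexists; eassumption.
have [fk lft mono] := heart_kernelE (dist_heart_kernel (A := to_heart hK)
  (B := A) (C := to_heart hI) d).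
have [mc lft' mono'] := heart_kernelE (dist_heart_kernel (A := to_heart hI)
  (B := B) (C := to_heart hQ) d').
split; last by exists h'.
- apply: heart_kernelP => //; first by rewrite fE -compA fk compm0.
  move=> W w hW; rewrite fE -compA => mew; apply: lft => //.
  exact: mono' mew.
- apply: heart_cokernelP; first by rewrite fE compA mc comp0m.
  + move=> W w hW; rewrite fE compA => wme; apply: (dist_ext d').
    by apply: (dist_epi d) wme; exact: heart_hom0_shift hK hW.
  + by move=> W w hW; apply: (dist_epi d'); exact: heart_hom0_shift hI hW.
Qed.

Lemma is_H0_hval Z : exists A, is_H0 t Z (hval A).
Proof. by have [A hA] := is_H0_exists t Z; exists (to_heart (proj1 hA)). Qed.

(** * Exactness of cohomology *)

(** If the degrees of P are at least 0 then H0 P maps to P, and W -> Z -> P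
    induces 0 -> H0 W -> H0 Z -> H0 P.  The fibre of H0 Z -> H0 P is compared
    with W by three fibre sequences, each with a term that H0 does not see. *)
Lemma is_H0_kernel W Z P C A :
  tri W Z P -> ge0 t P -> is_H0 t Z (hval C) -> is_H0 t P (hval A) ->
  exists (b : @hom (heart t) C A) (K : heart t) (k : @hom (heart t) K C),
    is_kernel b k /\ is_H0 t W (hval K).
Proof.
move=> [w [z [h d]]] P0 HZ HP.
have [V V1 [i [p [r dA]]]] := is_H0_ge0E P0 HP.
have [Z0 [Z1 [Z00 Z11 dZ]]] := truncation t Z.
have HZ0 : is_H0 t Z0 (hval C) by apply/(is_H0_sub _ dZ Z11).
have [N N0 [n [s [v dC]]]] := is_H0_le0E Z00 HZ0.
have [j [q [l dj]]] := dZ.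
have [z1 iz1] := dist_lift dA (le0_ge1 Z00 V1 (p ∘ (z ∘ j))).
have [b bs] := dist_ext dC (leN1_ge0 N0 (proj2 (hvalP A)) (z1 ∘ n)).
have [F fF] := fibre_exists b.
have [K [I [Q [k [m [c [[kK _ _] [_ _ dKQ]]]]]]]] :=
  heart_factor (has_cone_rot fF).
exists b, K, k; split=> //.
have FK : is_H0 t F (hval K).
  have dK : tri (hval K) F (unshift (hval Q)).
    apply: tri_iso (tri_unshift dKQ); try exact: isomorphic_refl;
      exact: unshift_shift.
  by apply/(is_H0_sub _ dK (proj2 (hvalP Q)))/is_H0_heart/hvalP.
have [W1 fW1] := fibre_exists z1.
have [W2 fW2] := fibre_exists (z ∘ j).
have NWF : tri N W1 F.
  apply: (octahedral_fibre (f := s) (g := b)) => //; last by rewrite bs.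
  by exists n, v.
have WWV : tri W1 W2 (unshift V).
  apply: (octahedral_fibre (f := z1) (g := i)) => //; last by rewrite iz1.
  have [i' ii'] := isomorphic_sym (shift_unshift V).
  by have [x [dx _]] := dist_inv_rot ii' dA; exists x, (i' ∘ p).
have ZWW : tri (unshift Z1) W2 W.
  apply: (octahedral_fibre (f := j) (g := z)) => //; last by exists w, h.
  have [i' ii'] := isomorphic_sym (shift_unshift Z1).
  by have [x [dx _]] := dist_inv_rot ii' dj; exists x, (i' ∘ q).
have WWZ : tri W2 W Z1.
  apply: tri_iso (tri_rot ZWW); try exact: isomorphic_refl.
  exact: shift_unshift.
apply/(is_H0_sub _ WWZ Z11).
apply/(is_H0_sub _ WWV (ge1_unshift V1)).
by apply/(is_H0_quot _ NWF N0).
Qed.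

(** On objects of degrees at most 0, H0 is left adjoint to the inclusion of the
    heart, hence right exact. *)
Lemma is_H0_cokernel P X S A B C :
  tri P X S -> le0 t P -> le0 t X -> le0 t S ->
  is_H0 t P (hval A) -> is_H0 t X (hval B) -> is_H0 t S (hval C) ->
  exists (a : @hom (heart t) A B) (b : @hom (heart t) B C), is_cokernel a b.
Proof.
move=> [p [q [r d]]] P0 X0 S0 HP HX HS.
have [N N0 [n [x [v dP]]]] := is_H0_le0E P0 HP.
have [N' N0' [n' [x' [v' dX]]]] := is_H0_le0E X0 HX.
have [N'' N0'' [n'' [x'' [v'' dS]]]] := is_H0_le0E S0 HS.
have [a ax] := dist_ext dP (leN1_ge0 N0 (proj2 (hvalP B)) (x' ∘ p ∘ n)).
have [b bx] := dist_ext dX (leN1_ge0 N0' (proj2 (hvalP C)) (x'' ∘ q ∘ n')).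
have epi M Y T (i : hom M Y) (e : hom Y T) (z : hom T (shift M)) W
    (w : hom T W) : dist i e z -> leN1 t M -> in_heart t W -> w ∘ e = 0 -> w = 0.
  move=> dd M0 hW; apply: (dist_epi dd).
  exact: leN1_ge0 (leN1_shifted M0) (proj2 hW).
exists a, b; apply: heart_cokernelP.
- apply: (epi _ _ _ _ _ _ _ _ dP N0 (hvalP C)).
  by rewrite -compA ax compA bx -!compA (dist_comp0 d) compm0.
- move=> W w hW wa.
  have [|y yq] := dist_ext (w := w ∘ x') d.
    by rewrite -compA -ax compA wa comp0m.
  have [u ux] := dist_ext dS (leN1_ge0 N0'' (proj2 hW) (y ∘ n'')).
  exists u; apply/eqP; rewrite -subr_eq0; apply/eqP.
  apply: (epi _ _ _ _ _ _ _ _ dX N0' hW).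
  by rewrite compBl -compA bx compA ux yq subrr.
- move=> W w hW wb; apply: (epi _ _ _ _ _ _ _ _ dS N0'' hW).
  apply: (dist_epi d); first exact: leN1_ge0 (leN1_shift P0) (proj2 hW).
  by rewrite -compA -bx compA wb comp0m.
Qed.

(** For X -> Y -> W of degrees at most 0, let S be the fibre of Y -> H0 W.  Then
    H0 S is the cokernel of H-1 W -> H0 X, and killing the part of degrees at
    most - 1 of S turns S -> Y -> H0 W into a triangle of the heart. *)
Lemma is_H0_coimage_le0 X Y W A B K C' :
  tri X Y W -> le0 t X -> le0 t Y -> le0 t W ->
  is_H0 t X (hval A) -> is_H0 t Y (hval B) -> is_H0 t W (hval K) ->
  is_H0 t (unshift W) (hval C') ->
  exists (a : @hom (heart t) C' A) (Q : heart t) (q : @hom (heart t) A Q),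
    is_cokernel a q /\ tri (hval Q) (hval B) (hval K).
Proof.
move=> [x [y [r d]]] X0 Y0 W0 HX HY HW HC.
have [N N0 dN] := is_H0_le0E W0 HW.
have [n [s [v ds]]] := dN.
have [S fS] := fibre_exists (s ∘ y).
have XSN : tri X S N.
  by apply: (octahedral_fibre (f := y) (g := s)) fS; do 2!eexists; eassumption.
have S0 : le0 t S by apply: le0_ext XSN X0 (leN1_le0 N0).
have [M [Q [M0 Q0 [m [c [z dQ]]]]]] := truncationN1 t S.
have MSQ : tri M S Q by exists m, c, z.
have hQ : in_heart t Q.
  by split=> //; apply: le0_ext (tri_rot MSQ) S0 (le0_shifted (leN1_le0 M0)).
have [k [l dk]] := fS.
have [B' [m1 [m2 dB']]] := dist_cone (k ∘ m).
have QBK : tri Q B' (hval K).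
  by apply: (octahedral_cone (f := m) (g := k)); do 2!eexists; eassumption.
have hB' : in_heart t B' by apply: in_heart_ext QBK hQ (hvalP K).
have HY' : is_H0 t Y B' by apply: (is_H0_intro M0 hB'); do 3!eexists; eassumption.
have HS : is_H0 t S (hval (to_heart hQ)) by apply: is_H0_intro M0 hQ MSQ.
have HN : is_H0 t (unshift N) (hval C').
  by apply/(is_H0_sub _ (tri_unshift dN) (proj2 (hvalP K))).
have [a [q aq]] := is_H0_cokernel (tri_inv_rot XSN) N0 X0 S0 HN HX HS.
exists a, (to_heart hQ), q; split=> //.
apply: tri_iso QBK; try exact: isomorphic_refl.
exact: is_H0_unique HY' HY.
Qed.

(** Only the truncation of W at 0 matters, and pulling Y back to it keeps the
    first vertex and makes all three degrees at most 0. *)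
Lemma is_H0_coimage X Y W A B K C' :
  tri X Y W -> le0 t X ->
  is_H0 t X (hval A) -> is_H0 t Y (hval B) -> is_H0 t W (hval K) ->
  is_H0 t (unshift W) (hval C') ->
  exists (a : @hom (heart t) C' A) (Q : heart t) (q : @hom (heart t) A Q),
    is_cokernel a q /\ tri (hval Q) (hval B) (hval K).
Proof.
move=> [x [y [r d]]] X0 HX HY HW HC.
have [W0 [W1 [W00 W11 dW]]] := truncation t W.
have [j [w [z dj]]] := dW.
have [Y0 fY0] := fibre_exists (w ∘ y).
have XYW : tri X Y0 W0.
  by apply: (octahedral_fibre (f := y) (g := w)) fY0; do 2!eexists; eassumption.
have [k [l dk]] := fY0.
have YYW : tri Y0 Y W1 by exists k, (w ∘ y), l.
apply: is_H0_coimage_le0 (XYW) (X0) _ (W00) HX _ _ _.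
- exact: le0_ext XYW X0 W00.
- by apply/(is_H0_sub _ YYW W11).
- by apply/(is_H0_sub _ dW W11).
- by apply/(is_H0_sub _ (tri_unshift dW) (ge1_unshift W11)).
Qed.

(** The part H-1 Z -> H0 X -> H0 Y -> H0 Z -> H1 X of the long exact sequence
    of a triangle, cut into the cokernel Q of its first map, the kernel K of its
    last map, and H0 Y as an extension of K by Q.  The octahedral axiom for
    X0 -> X -> Y, with X0 -> X -> X1 the truncation of X, splits the problem:
    the cone W of the composite satisfies H0 W = K and H-1 W = H-1 Z, and
    X0 -> Y -> W has a first vertex of degrees at most 0. *)
Lemma long_exact_sequence X Y Z A B C C' A' :
  tri X Y Z -> is_H0 t X (hval A) -> is_H0 t Y (hval B) -> is_H0 t Z (hval C) ->
  is_H0 t (unshift Z) (hval C') -> is_H0 t (shift X) (hval A') ->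
  exists (a : @hom (heart t) C' A) (b : @hom (heart t) C A') (Q K : heart t)
    (q : @hom (heart t) A Q) (k : @hom (heart t) K C),
    [/\ is_cokernel a q, is_kernel b k & tri (hval Q) (hval B) (hval K)].
Proof.
move=> [f [g [h d]]] HX HY HZ HZ' HX'.
have [X0 [X1 [X00 X11 dX]]] := truncation t X.
have [i [p [r di]]] := dX.
have [W [y [z dW]]] := dist_cone (f ∘ i).
have XYW : tri X0 Y W by exists (f ∘ i), y, z.
have XWZ : tri X1 W Z.
  by apply: (octahedral_cone (f := i) (g := f)); do 2!eexists; eassumption.
have HX1 : is_H0 t (shift X1) (hval A').
  by apply/(is_H0_quot _ (tri_shift dX) (leN1_shift X00)).
have [b [K [k [bk HW]]]] := is_H0_kernel (tri_rot XWZ) (ge0_shift X11) HZ HX1.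
have HW' : is_H0 t (unshift W) (hval C').
  by apply/(is_H0_sub _ (tri_unshift (tri_rot XWZ)) (ge0_shift X11)).
have HX0 : is_H0 t X0 (hval A) by apply/(is_H0_sub _ dX X11).
have [a [Q [q [aq dQ]]]] := is_H0_coimage XYW X00 HX0 HY HW HW'.
by exists a, b, Q, K, q, k.
Qed.

(** * ICE-closed subcategories of the heart *)

Lemma extension_closed_tri (P : set (heart t)) A B C :
  extension_closed P -> tri (hval A) (hval B) (hval C) -> P A -> P C -> P B.
Proof.
move=> Pext [f [g [h d]]]; apply: (Pext _ _ _ f g).
by split; [apply: dist_heart_kernel d|apply: dist_heart_cokernel d].
Qed.

(** Membership in P of one choice of image and cokernel passes to every other
    choice. *)
Lemma ICE_image (P : set (heart t)) A B Q I (f : @hom (heart t) A B)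
    (c : @hom (heart t) B Q) (m : @hom (heart t) I B) :
  ICE_closed P -> P A -> P B -> is_cokernel f c -> is_kernel c m -> P I /\ P Q.
Proof.
move=> [Psub _ Pic] PA PB fc cm.
have [[J [n [[Q' [c' [fc' cn]]] PJ]]] [Q1 [c1 [fc1 PQ1]]]] := Pic A B f PA PB.
have [_ _ Piso] := Psub.
split; last by apply: Piso PQ1; apply: cokernel_unique fc1 fc.
apply: Piso PJ; apply: (kernel_unique cn (l := m)).
have [u [uc _]] := (proj2 fc') _ c (proj1 fc).
have [v [vc _]] := (proj2 fc) _ c' (proj1 fc').
apply: is_kernelP; first by rewrite -vc -compA (proj1 cm) compm0.
- move=> W w c'w; have [|x [cx _]] := (proj2 cm) W w; last by exists x.
  by rewrite -uc -compA c'w compm0.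
- exact: kernel_mono cm.
Qed.

Lemma alpha_sub (P : set (heart t)) A B (m : @hom (heart t) A B) :
  (forall C (w : @hom (heart t) C A), m ∘ w = 0 -> w = 0) ->
  alpha P B -> P A -> alpha P A.
Proof.
move=> mono [_ Bker] PA; split=> // C f PC.
have [K [k [[fk kP] PK]]] := Bker C (m ∘ f) PC.
exists K, k; split=> //; split; first by apply: mono; rewrite compA.
by move=> W w fw; apply: kP; rewrite -compA fw compm0.
Qed.

Lemma alpha_kernel (P : set (heart t)) A B K (f : @hom (heart t) A B)
    (k : @hom (heart t) K A) :
  subcategory P -> is_kernel f k -> alpha P A -> alpha P B -> alpha P K.
Proof.
move=> [_ _ Piso] fk [PA Aker] [_ Bker].
have PK : P K.
  have [L [l [fl PL]]] := Bker A f PA.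
  by apply: Piso PL; apply: kernel_unique fl fk.
by apply: (alpha_sub (kernel_mono fk)).
Qed.

(** A map s from an object of P to the quotient Q of B by I is tested on the
    pullback E of s and B -> Q: it is an extension, so it lies in P, and the
    kernels of E -> B and of s agree. *)
Lemma alpha_quotient (P : set (heart t)) I B Q (m : @hom D (hval I) (hval B))
    (c : @hom D (hval B) (hval Q)) h :
  extension_closed P -> dist m c h -> P I -> alpha P B -> P Q -> alpha P Q.
Proof.
move=> Pext d PI [PB Bker] PQ; split=> // T s PT.
have [E0 [v [r dE]]] := fibre_exists (h ∘ (s : @hom D (hval T) (hval Q))).
have [i [dT _]] := dist_inv_rot (iso_id _) dE; rewrite comp1m in dT.
have hE : in_heart t E0.
  by apply: in_heart_ext (hvalP I) (hvalP T); do 3!eexists; apply: dT.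
pose E := to_heart hE.
have PE : P E.
  by apply: (extension_closed_tri Pext _ PI PT); do 3!eexists; apply: dT.
have [|x [xi xv]] := dist_morphism (a := (s : @hom D (hval T) (hval Q)))
    (b := idm (shift (hval I))) (dist_rot (dist_rot dT)) (dist_rot (dist_rot d)).
  by rewrite comp1m.
have [p px] := shift_full x; subst x.
have pi : p ∘ i = m.
  apply/eqP; rewrite -subr_eq0; apply/eqP; apply: shift_faithful.
  move/eqP: xi; rewrite raddfB compmN compm1 -fmap_comp eqr_opp => /eqP ->.
  by rewrite subrr.
have cp : c ∘ p = (s : @hom D (hval T) (hval Q)) ∘ v.
  apply/eqP; rewrite -subr_eq0; apply/eqP; apply: shift_faithful.
  move/eqP: xv; rewrite raddfB compmN compNm -!fmap_comp eqr_opp => /eqP ->.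
  by rewrite subrr.
have [K [k [kK PK]]] := Bker E p PE.
have [pk klift kmono] := heart_kernelE (A := E) (B := B) (C := K) kK.
exists K, (v ∘ (k : @hom D (hval K) (hval E))); split=> //.
apply: heart_kernelP.
- by rewrite compA -cp -compA pk compm0.
- move=> W w hW sw.
  have [|w1 vw] := dist_lift2 (w := w) dT; first by rewrite -compA sw compm0.
  have [|y my] := dist_lift (w := p ∘ w1) d.
    by rewrite compA cp -compA vw.
  have [|u ku] := klift W (w1 - i ∘ y) hW.
    by rewrite compBr [p ∘ (i ∘ y)]compA pi my subrr.
  exists u; rewrite -compA ku compBr vw compA (dist_comp0 dT) comp0m.
  by rewrite subr0.
- move=> W w hW; rewrite -compA => vkw; apply: (kmono W w hW).
  have [y iy] := dist_lift dT vkw.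
  suff y0 : y = 0 by rewrite -iy y0 compm0.
  apply: (dist_mono d); first exact: heart_hom0_shift hW (hvalP Q).
  by rewrite -pi -compA iy compA pk comp0m.
Qed.

End HeartLemmas.

(** * The heart of a preaisle *)

Section FromPreaisles.
Variables (D : triangulated) (t : t_structure D).
Implicit Types (X Y Z : D) (A B C : heart t).

Lemma cone_cohomology Z A B :
  tri (shift (hval A)) Z (hval B) ->
  is_H0 t Z (hval B) /\ is_H0 t (unshift Z) (hval A).
Proof.
move=> d; have [A0 _] := hvalP A; split.
  exact: is_H0_intro (leN1_shift A0) (hvalP B) d.
have [_ B0] := hvalP B.
apply/(is_H0_sub _ (tri_unshift d) B0).
apply: is_H0_iso (is_H0_heart (hvalP A)); last exact: isomorphic_refl.
exact/isomorphic_sym/unshift_shift.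
Qed.

(** Epimorphisms of the wide subcategory alpha P are epimorphisms of the heart,
    because their cokernel in the heart lies in alpha P. *)
Lemma alpha_epi (P : set (heart t)) A B (f : @hom (heart t) A B) :
  ICE_closed P -> alpha P A -> alpha P B ->
  (forall C (w : @hom (heart t) B C), alpha P C -> w ∘ f = 0 -> w = 0) ->
  exists (K : heart t) (k : @hom (heart t) K A),
    [/\ is_kernel f k, alpha P K & tri (hval K) (hval A) (hval B)].
Proof.
move=> Pice aA aB epi; have [Psub Pext _] := Pice.
have [Z fZ] := dist_cone (f : @hom D (hval A) (hval B)).
have [K [I [Q [k [m [c [[fk fc [h d]] [KAI IBQ _]]]]]]]] := heart_factor fZ.
have [PI PQ] := ICE_image Pice (proj1 aA) (proj1 aB) fc (dist_heart_kernel d).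
exists K, k; split=> //; first by apply: alpha_kernel fk _ _.
have aQ := alpha_quotient Pext d PI aB PQ.
apply: tri_iso KAI; try exact: isomorphic_refl.
apply: (dist_zero_iso d); apply/hval_zero/is_zeroP.
by apply: (cokernel_epi fc); rewrite comp1m; apply: epi aQ (proj1 fc).
Qed.

Lemma short_exact_tri A B C (f : @hom (heart t) A B) (g : @hom (heart t) B C) :
  short_exact f g -> tri (hval A) (hval B) (hval C).
Proof.
move=> [gf fg].
have [Z gZ] := dist_cone (g : @hom D (hval B) (hval C)).
have [K [I [Q [k [m [c [[gk gc [h d]] [KBI _ _]]]]]]]] := heart_factor gZ.
apply: tri_iso KBI; last 1 first.
- apply: (dist_zero_iso d); apply/hval_zero/is_zeroP.
  apply: (cokernel_epi gc); rewrite comp1m.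
  exact: cokernel_epi fg _ _ (proj1 gc).
- exact: kernel_unique gk gf.
- exact: isomorphic_refl.
Qed.

(** The conditions on V = U[k] that make the heart of V an ICE-closed
    subcategory of which the heart of V[1] is a torsion class. *)
Record cohomological (V : set D) : Prop := Cohomological {
  coh_iso : forall X Y, isomorphic X Y -> V X -> V Y;
  coh_zero : forall O : D, is_zero O -> V O;
  coh_shift : forall X, V X -> V (shift X);
  coh_ext : forall X Y Z, tri X Y Z -> V X -> V Z -> V Y;
  coh_H0 : forall X Y, is_H0 t X Y -> V X -> V Y;
  coh_HN1 : forall X Y, is_H0 t (unshift X) Y -> V X -> V (shift Y) }.

Variable V : set D.
Hypothesis cohV : cohomological V.

Let P : set (heart t) := [set A | V (hval A)].
Let T : set (heart t) := [set A | V (unshift (hval A))].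

Lemma heart_part_subcategory : subcategory P.
Proof.
split.
- by move=> O /hval_zero; apply: coh_zero.
- by move=> A B C /(@tri_biproduct D (hval A) (hval B)); apply: coh_ext.
- by move=> A B; apply: coh_iso.
Qed.

Lemma cone_in X Y Z : tri X Y Z -> V X -> V Y -> V Z.
Proof. by move=> /tri_rot d /(coh_shift cohV) VX VY; apply: coh_ext d VY VX. Qed.

Lemma unshift_cone_in X Y Z : tri X Y Z -> V X -> V (unshift Y) -> V (unshift Z).
Proof.
move=> /tri_rot /tri_unshift d VX VY; apply: (coh_ext cohV d VY).
by apply: (coh_iso cohV) VX; apply/isomorphic_sym/unshift_shift.
Qed.

(** For f in the heart of V, the cone lies in V, so V contains coker f and
    (ker f)[1]; the image is an extension of (ker f)[1] by the source. *)
Lemma heart_part_ICE : ICE_closed P.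
Proof.
split; first exact: heart_part_subcategory.
  by move=> A B C f g /short_exact_tri; apply: coh_ext.
move=> A B f VA VB.
have [Z fZ] := dist_cone (f : @hom D (hval A) (hval B)).
have [K [I [Q [k [m [c [[fk fc [h d]] [KAI IBQ KZQ]]]]]]]] := heart_factor fZ.
have VZ : V Z.
  by have [g [h' d']] := fZ; apply: cone_in VA VB; do 3!eexists; apply: d'.
have [HZQ HZK] := cone_cohomology KZQ.
have VQ := coh_H0 cohV HZQ VZ; have VK := coh_HN1 cohV HZK VZ.
split; last by exists Q, c.
exists I, m; split; first by exists Q, c; split=> //; apply: dist_heart_kernel d.
exact: coh_ext (tri_rot KAI) VA VK.
Qed.

Lemma heart_part_shift : T `<=` P.
Proof.
move=> A /(coh_shift cohV); apply: (coh_iso cohV); exact: shift_unshift.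
Qed.

(** For f from B in V to A in V[1], the fibre Z[-1] of f is an extension of B
    by A[-1], hence lies in V, and ker f is its cohomology in degree 0. *)
Lemma heart_part_alpha : T `<=` alpha P.
Proof.
move=> A TA; split=> [|B f VB]; first exact: heart_part_shift.
have [Z fZ] := dist_cone (f : @hom D (hval B) (hval A)).
have [K [I [Q [k [m [c [[fk _ _] [_ _ KZQ]]]]]]]] := heart_factor fZ.
exists K, k; split=> //; have [_ HZK] := cone_cohomology KZQ.
apply: (coh_H0 cohV HZK).
by have [g [h' d']] := fZ; apply: unshift_cone_in VB TA; do 3!eexists; apply: d'.
Qed.

(** Over alpha P, an epimorphism A -> B with A in V[1] has its kernel K in V, so
    that B is in V[1] as the cone of K -> A. *)
Lemma heart_part_torsion : torsion_class_in (alpha P) T.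
Proof.
split; first exact: heart_part_alpha.
have Pice := heart_part_ICE.
split; first split.
- move=> O /is_zeroP zO; apply: (coh_zero cohV); apply: fmap_zero.
  exact/is_zeroP.
- move=> A B C /(@tri_biproduct D (hval (sval A)) (hval (sval B))).
  by move=> /tri_unshift; apply: coh_ext.
- move=> A B AB; apply: (coh_iso cohV); exact: (fmap_iso unshift AB).
- move=> A B C f g [gf fg] TA TC.
  have [|K [k [gk aK KBC]]] := alpha_epi (f := g) Pice (svalP B) (svalP C).
    by move=> E w aE; apply: (cokernel_epi fg (W := exist _ E aE)).
  have KA : isomorphic (hval K) (hval (sval A)).
    apply: (@kernel_unique (full_subcategory (alpha P)) B C (exist _ K aK) A
      g k f) gf.
    split; first exact: (proj1 gk).
    by move=> W; apply: (proj2 gk).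
  apply: (coh_ext cohV (tri_unshift KBC)) TC.
  by apply: (coh_iso cohV) TA; apply/isomorphic_sym/fmap_iso.
- move=> A B f epif TA.
  have [|K [k [fk [VK _] KAB]]] := alpha_epi (f := f) Pice (svalP A) (svalP B).
    move=> E w aE wf; apply: (epif (exist _ E aE)).
    by rewrite comp0m; exact: wf.
  exact: unshift_cone_in KAB VK TA.
Qed.

End FromPreaisles.

(** * Cohomology in all degrees *)

Section ShiftedCohomology.
Variables (D : triangulated) (t : t_structure D).
Implicit Types (X Y Z : D).

Lemma leN1_shiftz n X : le0 t X -> leN1 t (shiftz n.+1%:Z X).
Proof.
move=> X0; elim: n => [|n IH]; first exact: leN1_shift.
exact: leN1_shifted IH.
Qed.

Lemma ge1_shiftz n X : ge0 t X -> ge1 t (shiftz (Negz n) X).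
Proof. by move=> X0; elim: n => // n IH; apply: ge1_unshift IH. Qed.

Lemma is_H0_Hk k X : is_H0 t (shiftz k X) (Hk t k X).
Proof.
rewrite /Hk /H0; move: (shiftz k X) => {k}X.
rewrite /tau_le0; case: cid => -[U V] [/= U0 V1 dX].
rewrite /tau_ge0 /tau_ge1; case: cid => -[N A] [/= N0 A1 dU].
have d : tri (shift N) U (shift A).
  apply: tri_iso (tri_shift (dU : tri N (unshift U) A));
    by [exact: isomorphic_refl|exact: shift_unshift].
apply/(is_H0_sub _ (dX : tri U X V) V1).
apply: is_H0_intro (leN1_shift N0) _ (d); split; last exact: ge0_shift.
by apply: le0_ext (tri_rot d) U0 _; do 2!apply: le0_shifted.
Qed.

Lemma shift_subP (U : set D) k X :
  (forall Y Z, isomorphic Y Z -> U Y -> U Z) ->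
  shift_sub k U X <-> U (shiftz (- k) X).
Proof.
move=> Uiso; split=> [[Y UY XY]|UX].
  apply: Uiso UY; apply: isomorphic_sym.
  exact: isomorphic_trans (shiftz_iso _ XY) (shiftzNK _ _).
by exists (shiftz (- k) X) => //; apply/isomorphic_sym/shiftzK.
Qed.

Lemma homology_determinedP (U : set D) :
  (forall Y Z, isomorphic Y Z -> U Y -> U Z) ->
  homology_determined t U <->
  forall X, U X <-> forall k A, is_H0 t (shiftz k X) A -> U (shiftz (- k) A).
Proof.
move=> Uiso; split=> hd X; (split=> [/hd UX k|UX]).
- move=> A HA; have /(shift_subP _ _ Uiso) := UX k; apply: Uiso.
  by apply: shiftz_iso; apply: is_H0_unique HA; apply: is_H0_Hk.
- apply/hd => k; apply/(shift_subP _ _ Uiso); apply: UX; exact: is_H0_Hk.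
- by apply/(shift_subP _ _ Uiso); apply: UX; apply: is_H0_Hk.
- apply/hd => k A HA; have /(shift_subP _ _ Uiso) := UX k; apply: Uiso.
  by apply: shiftz_iso; apply: is_H0_unique HA; apply: is_H0_Hk.
Qed.

End ShiftedCohomology.

(** * The correspondence *)

Section Correspondence.
Variables (D : triangulated) (t : t_structure D).
Implicit Types (X Y Z : D) (A B : heart t) (U : set D) (C : int -> set (heart t)).

Definition preaisle_of C : set D :=
  [set X | forall k, exists A, C k A /\ is_H0 t (shiftz k X) (hval A)].

Definition sequence_of U : int -> set (heart t) :=
  fun k => [set A | U (shiftz (- k) (hval A))].

Lemma preaisle_tri U X Y Z : preaisle U -> tri X Y Z -> U X -> U Z -> U Y.
Proof. by move=> [_ _ Uext] [f [g [h d]]]; apply: Uext d. Qed.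

Lemma cohomological_shiftz U k :
  preaisle U -> homology_determined t U ->
  cohomological t [set X | U (shiftz (- k) X)].
Proof.
move=> Upre; have [[U0 _ Uiso] Ush _] := Upre.
move=> /(homology_determinedP t Uiso) Uhd.
split=> [X Y XY|O zO|X UX|X Y Z d|X Y HX UX|X Y HX UX].
- by apply: Uiso; apply: shiftz_iso.
- by apply: U0; apply: shiftz_zero.
- apply: Ush; exists (shiftz (- k) X) => //; exact: shiftz_shift.
- by apply: preaisle_tri Upre _; apply: shiftz_tri.
- have /Uhd := UX; apply.
  by apply: is_H0_iso HX; [apply/isomorphic_sym/shiftzK|apply: isomorphic_refl].
- have /Uhd/(_ (k - 1) Y) UY := UX.
  apply: (Uiso (shiftz (- (k - 1)) Y)).
    by rewrite opprB addrC; apply: shiftzD.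
  apply: UY; apply: is_H0_iso HX; last exact: isomorphic_refl.
  apply: isomorphic_sym; apply: isomorphic_trans (shiftzP _ _) _.
  exact/fmap_iso/shiftzK.
Qed.

Lemma sequence_of_ICE U :
  preaisle U -> homology_determined t U -> ICE_sequence (sequence_of U).
Proof.
move=> Upre Uhd k; have cohU := cohomological_shiftz k Upre Uhd.
split; first exact: heart_part_ICE cohU.
have -> : sequence_of U (k + 1) =
    [set A : heart t | U (shiftz (- k) (unshift (hval A)))].
  have [[_ _ Uiso] _ _] := Upre.
  have e (A : heart t) :
      isomorphic (shiftz (- (k + 1)) (hval A)) (shiftz (- k) (unshift (hval A))).
    by rewrite opprD; apply: shiftzD.
  by apply/seteqP; split=> A; apply: Uiso; [|apply: isomorphic_sym]; apply: e.
exact: heart_part_torsion cohU.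
Qed.

Section FromSequence.
Variable C : int -> set (heart t).
Hypothesis Cice : ICE_sequence C.

Lemma ICE_sequence_iso k A B : isomorphic (hval A) (hval B) -> C k A -> C k B.
Proof. by have [[[_ _ +] _ _] _] := Cice k => Ciso AB; apply: Ciso. Qed.

Lemma ICE_sequence_alpha k : C (k + 1) `<=` alpha (C k).
Proof. by have [_ []] := Cice k. Qed.

Lemma ICE_sequence_succ k : C (k + 1) `<=` C k.
Proof. by move=> A /ICE_sequence_alpha []. Qed.

Lemma ICE_sequence_kernel k A B K (b : @hom (heart t) A B)
    (i : @hom (heart t) K A) :
  C k A -> C (k + 1) B -> is_kernel b i -> C k K.
Proof.
move=> CA /ICE_sequence_alpha [_ Bker] bi.
have [L [l [bl CL]]] := Bker A b CA.
by apply: ICE_sequence_iso CL; apply: (kernel_unique bl bi).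
Qed.

(** The quotient Q of B by the image of a lies in alpha (C k), where B -> Q is an
    epimorphism; so the torsion class C (k + 1) contains Q. *)
Lemma ICE_sequence_cokernel k A B Q (a : @hom (heart t) A B)
    (q : @hom (heart t) B Q) :
  C k A -> C (k + 1) B -> is_cokernel a q -> C (k + 1) Q.
Proof.
move=> CA CB aq; have aB := ICE_sequence_alpha CB.
have [Pice [_ [_ _ Tquo]]] := Cice k; have [_ Pext _] := Pice.
have [Z aZ] := dist_cone (a : @hom D (hval A) (hval B)).
have [K [I [E [i [m [c [[ai ac [h d]] _]]]]]]] := heart_factor aZ.
have [CI CE] := ICE_image Pice CA (proj1 aB) ac (dist_heart_kernel d).
have aE := alpha_quotient Pext d CI aB CE.
apply: (@ICE_sequence_iso _ E); first exact: cokernel_unique ac aq.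
apply: (Tquo (exist _ B aB) (exist _ E aE) c) => // -[G aG] w1 w2 /= e.
apply/eqP; rewrite -subr_eq0; apply/eqP; apply: (cokernel_epi ac).
by rewrite compBl; apply/eqP; rewrite subr_eq0; apply/eqP.
Qed.

Lemma preaisle_of_iso X Y :
  isomorphic X Y -> preaisle_of C X -> preaisle_of C Y.
Proof.
move=> XY CX k; have [A [CA HA]] := CX k; exists A; split=> //.
by apply: is_H0_iso HA; [apply: shiftz_iso|apply: isomorphic_refl].
Qed.

Lemma preaisle_of_H0 X k A :
  preaisle_of C X -> is_H0 t (shiftz k X) (hval A) -> C k A.
Proof.
move=> CX HA; have [B [CB HB]] := CX k.
by apply: ICE_sequence_iso CB; apply: is_H0_unique HB HA.
Qed.

Lemma preaisle_of_zero O : is_zero O -> preaisle_of C O.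
Proof.
move=> zO k; exists (to_heart (in_heart_zero t zO)); split.
  by have [[[C0 _ _] _ _] _] := Cice k; apply/C0/hval_zero.
apply: is_H0_iso (is_H0_heart (in_heart_zero t zO)); last exact: isomorphic_refl.
by apply: isomorphic_zero => //; apply: shiftz_zero.
Qed.

(** By the long exact sequence, H^k Y is an extension of the kernel of
    H^k Z -> H^(k+1) X by the cokernel of H^(k-1) Z -> H^k X, and the ICE
    sequence conditions put both in C k. *)
Lemma preaisle_of_ext X Y Z :
  tri X Y Z -> preaisle_of C X -> preaisle_of C Z -> preaisle_of C Y.
Proof.
move=> d CX CZ k; have [A [CA HA]] := CX k; have [B [CB HB]] := CZ k.
have [A' [CA' HA']] := CX (k + 1); have [B' [CB' HB']] := CZ (k - 1).
have [E HE] := is_H0_hval t (shiftz k Y); exists E; split=> //.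
have HA2 : is_H0 t (shift (shiftz k X)) (hval A').
  by apply: is_H0_iso HA'; [apply: shiftzS|apply: isomorphic_refl].
have HB2 : is_H0 t (unshift (shiftz k Z)) (hval B').
  by apply: is_H0_iso HB'; [apply: shiftzP|apply: isomorphic_refl].
have [a [b [Q [K [q [i [aq bi QEK]]]]]]] :=
  long_exact_sequence (shiftz_tri k d) HA HE HB HB2 HA2.
have CK := ICE_sequence_kernel CB CA' bi.
have CQ : C k Q.
  rewrite -[k](subrK 1); apply: (ICE_sequence_cokernel CB' _ aq).
  by rewrite subrK.
have [[_ Cext _] _] := Cice k.
exact: extension_closed_tri Cext QEK CQ CK.
Qed.

Lemma preaisle_of_preaisle : preaisle (preaisle_of C).
Proof.
split.
- split; [exact: preaisle_of_zero| |exact: preaisle_of_iso].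
  by move=> X Y Z /tri_biproduct; apply: preaisle_of_ext.
- move=> Y [X CX YX]; apply: preaisle_of_iso (isomorphic_sym YX) _ => k.
  have [A [CA HA]] := CX (k + 1); exists A; split; first exact: ICE_sequence_succ.
  by apply: is_H0_iso HA; [apply: shiftzD|apply: isomorphic_refl].
- by move=> X Y Z f g h d; apply: preaisle_of_ext; exists f, g, h.
Qed.

(** The object A[-k] has cohomology A in degree k and 0 in the other degrees. *)
Lemma preaisle_of_heart k A : preaisle_of C (shiftz (- k) (hval A)) <-> C k A.
Proof.
have HA := is_H0_heart (hvalP A); split=> [CA|CA j].
  apply: preaisle_of_H0 CA _.
  by apply: is_H0_iso HA; [apply/isomorphic_sym/shiftzK|apply: isomorphic_refl].
have [->|jk] := eqVneq j k.
  exists A; split=> //; apply: is_H0_iso HA; last exact: isomorphic_refl.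
  exact/isomorphic_sym/shiftzK.
have [[O zO] _] := tri_additive D.
exists (to_heart (in_heart_zero t zO)); split.
  by have [[[C0 _ _] _ _] _] := Cice j; apply/C0/hval_zero.
apply: is_H0_iso (shiftzD j (- k) (hval A)) (isomorphic_refl O) _.
have [A0 A0'] := hvalP A.
move: jk; rewrite -subr_eq0; case: (j - k) => [[|n]|n] // _.
- exact: is_H0_leN1 (leN1_shiftz n A0) zO.
- exact: is_H0_ge1 (ge1_shiftz n A0') zO.
Qed.

Lemma preaisle_of_homology_determined : homology_determined t (preaisle_of C).
Proof.
apply/(homology_determinedP t preaisle_of_iso) => X; split=> [CX k B HB|CX k].
  apply/(preaisle_of_heart k (to_heart (proj1 HB))).
  exact: (preaisle_of_H0 (A := to_heart (proj1 HB)) CX HB).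
have [A HA] := is_H0_hval t (shiftz k X); exists A; split=> //.
by apply/preaisle_of_heart/CX.
Qed.

End FromSequence.

Lemma sequence_ofK U :
  preaisle U -> homology_determined t U -> preaisle_of (sequence_of U) = U.
Proof.
move=> [[_ _ Uiso] _ _] /(homology_determinedP t Uiso) Uhd.
apply/seteqP; split=> X.
- move=> CX; apply/Uhd => k B HB; have [A [UA HA]] := CX k.
  by apply: Uiso UA; apply/shiftz_iso/(is_H0_unique HA HB).
- move=> /Uhd UX k; have [A HA] := is_H0_hval t (shiftz k X).
  by exists A; split=> //; apply: UX.
Qed.

Lemma preaisle_ofK C : ICE_sequence C -> sequence_of (preaisle_of C) = C.
Proof.
move=> Cice; apply/funext => k; apply/seteqP.
by split=> A /(preaisle_of_heart Cice).
Qed.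

End Correspondence.

Theorem theorem1 (D : triangulated) (t : t_structure D) :
  exists f : (int -> set (heart t)) -> set D,
    set_bij [set C | ICE_sequence C]
            [set U | preaisle U /\ homology_determined t U] f.
Proof.
exists (@preaisle_of D t); split.
- move=> C Cice; split; first exact: preaisle_of_preaisle.
  exact: preaisle_of_homology_determined.
- move=> C C' /set_mem Cice /set_mem Cice' e.
  by rewrite -(preaisle_ofK Cice) e preaisle_ofK.
- move=> U [Upre Uhd]; exists (sequence_of U); last exact: sequence_ofK.
  exact: sequence_of_ICE.
Qed.
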